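(* For every fixed constant number of machines $m$, the problem $Qm|cap|C_{\max}$ can be solved in $\widetilde{O}(p_{\max}^{4m+2}+n)$ time, where $n$ is the number of jobs and $p_{\max}=\max_{j\in[n]}p_j$.
   Context: Problem $Qm|cap|C_{\max}$: given $n$ jobs $J=[n]$ with processing requirements $p_j\in\mathbb{N}$, $m$ machines $M_1,\dots,M_m$ with positive speeds $q_i$ and capacities $b_i\in\mathbb{N}$, the processing time of job $j$ on $M_i$ is $p_j/q_i$. A schedule is a map $\sigma:[n]\to[m]$; it is feasible if $|\sigma^{-1}(i)|\le b_i$ for all $i\in[m]$. The load of $M_i$ is $M_i(\sigma)=\sum_{j\in\sigma^{-1}(i)}p_j/q_i$ and the makespan is $\max_i M_i(\sigma)$. The goal is to find a feasible schedule of minimum makespan. The number $m$ is a fixed constant. $\widetilde{O}(\cdot)$ suppresses polylogarithmic factors. *)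

(* Defs.v *)
From HB Require Import structures.
From mathcomp Require Import all_boot all_order all_algebra.

Set Implicit Arguments.
Unset Strict Implicit.
Unset Printing Implicit Defensive.

Import Order.TTheory GRing.Theory Num.Theory.

(* The speeds are positive rationals, so that an instance is a finite object
   that a machine can read.  There is at least one job, so that p_max makes
   sense. *)
Record instance (m : nat) := Instance {
  njobs : nat;
  proc : 'I_njobs -> nat;
  speed : 'I_m -> rat;
  capacity : 'I_m -> nat;
  njobs_gt0 : 0 < njobs;
  speed_gt0 : forall i, (0 < speed i)%R
}.

Section Problem.
Variables (m : nat) (I : instance m).

Definition schedule := {ffun 'I_(njobs I) -> 'I_m}.

Definition p_max : nat := \max_(j < njobs I) proc j.

Definition feasible (sigma : schedule) : Prop :=
  forall i : 'I_m, #|[set j | sigma j == i]| <= capacity I i.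

Definition load (sigma : schedule) (i : 'I_m) : rat :=
  (\sum_(j | sigma j == i) (proc j)%:R / speed I i)%R.

(* Loads are nonnegative, hence the default value 0 is harmless. *)
Definition makespan (sigma : schedule) : rat :=
  \big[Num.max/0%R]_(i < m) load sigma i.

Definition optimal (sigma : schedule) : Prop :=
  feasible sigma /\
  forall tau : schedule, feasible tau -> (makespan sigma <= makespan tau)%R.

End Problem.

(* Unit-cost word RAM.  Control flow is structured; up to a constant factor in
   the running time this is the same as a RAM with jumps. *)

Inductive binop := Add | Sub | Mul | Div | Mod | Lt | Eq.

Inductive expr :=
  | Const of nat
  | Reg of nat
  | Read of expr
  | Bin of binop & expr & expr.

Inductive cmd :=
  | Skip
  | Assign of nat & expr
  | Write of expr & expr
  | Seq of cmd & cmd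
  | If of expr & cmd & cmd
  | While of expr & cmd.

Record state := State { regs : nat -> nat; mem : nat -> nat }.

Definition update (f : nat -> nat) (a v : nat) : nat -> nat :=
  fun x => if x == a then v else f x.

Definition eval_binop (o : binop) (x y : nat) : nat :=
  match o with
  | Add => x + y
  | Sub => x - y
  | Mul => x * y
  | Div => x %/ y
  | Mod => x %% y
  | Lt => x < y
  | Eq => x == y
  end.

Fixpoint eval (s : state) (e : expr) : nat :=
  match e with
  | Const c => c
  | Reg x => regs s x
  | Read a => mem s (eval s a)
  | Bin o e1 e2 => eval_binop o (eval s e1) (eval s e2)
  end.

Fixpoint cost (e : expr) : nat :=
  match e with
  | Const _ | Reg _ => 1
  | Read a => (cost a).+1
  | Bin _ e1 e2 => (cost e1 + cost e2).+1
  end.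

(* Every value (in particular every address) arising in the evaluation of e is
   at most W, i.e. fits in a machine word. *)
Fixpoint fits (W : nat) (s : state) (e : expr) : bool :=
  (eval s e <= W) &&
  match e with
  | Const _ | Reg _ => true
  | Read a => fits W s a
  | Bin _ e1 e2 => fits W s e1 && fits W s e2
  end.

(* exec W c s t s': started in s, c terminates in s' after t unit-cost
   operations, never producing a value larger than W.  An overflow makes the
   execution stuck. *)
Inductive exec (W : nat) : cmd -> state -> nat -> state -> Prop :=
  | ExecSkip s : exec W Skip s 1 s
  | ExecAssign x e s :
      fits W s e ->
      exec W (Assign x e) s (cost e).+1
        (State (update (regs s) x (eval s e)) (mem s))
  | ExecWrite a e s :
      fits W s a -> fits W s e ->
      exec W (Write a e) s (cost a + cost e).+1
        (State (regs s) (update (mem s) (eval s a) (eval s e)))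
  | ExecSeq c1 c2 s1 s2 s3 t1 t2 :
      exec W c1 s1 t1 s2 -> exec W c2 s2 t2 s3 ->
      exec W (Seq c1 c2) s1 (t1 + t2) s3
  | ExecIfTrue e c1 c2 s s' t :
      fits W s e -> eval s e != 0 -> exec W c1 s t s' ->
      exec W (If e c1 c2) s ((cost e).+1 + t) s'
  | ExecIfFalse e c1 c2 s s' t :
      fits W s e -> eval s e = 0 -> exec W c2 s t s' ->
      exec W (If e c1 c2) s ((cost e).+1 + t) s'
  | ExecWhileTrue e c s1 s2 s3 t1 t2 :
      fits W s1 e -> eval s1 e != 0 ->
      exec W c s1 t1 s2 -> exec W (While e c) s2 t2 s3 ->
      exec W (While e c) s1 ((cost e).+1 + t1 + t2) s3
  | ExecWhileFalse e c s :
      fits W s e -> eval s e = 0 ->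
      exec W (While e c) s (cost e).+1 s.

Section Solving.
Variable m : nat.

(* n, then numerator and denominator of q_i and b_i for each machine i, then
   p_1, ..., p_n. *)
Definition encode (I : instance m) : seq nat :=
  njobs I ::
  flatten [seq [:: `|numq (speed I i)|%N; `|denq (speed I i)|%N; capacity I i]
          | i <- enum 'I_m] ++
  [seq proc j | j <- enum 'I_(njobs I)].

Definition input_state (I : instance m) : state :=
  State (fun=> 0) (nth 0 (encode I)).

(* Bounds the input length and all input numbers. *)
Definition magnitude (I : instance m) : nat :=
  size (encode I) + \max_(x <- encode I) x.

(* Cell 0 tells whether there is a feasible schedule; if so, the following n
   cells contain an optimal one. *)
Definition correct_output (I : instance m) (s : state) : Prop :=
  (mem s 0 = 1 /\
   exists sigma : schedule I,
     optimal sigma /\ forall j : 'I_(njobs I), mem s j.+1 = sigma j)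
  \/ (mem s 0 = 0 /\ ~ exists sigma : schedule I, feasible sigma).

(* A single program solves every instance I in at most T I operations, with
   words of O(log (magnitude I)) bits. *)
Definition solvable_in_time (T : instance m -> nat) : Prop :=
  exists (prog : cmd) (c : nat), forall I : instance m,
    exists (t : nat) (s : state),
      [/\ exec (magnitude I ^ c) prog (input_state I) t s,
          t <= T I & correct_output I s].

End Solving.

(* T is in O(f * polylog f); the successor keeps the logarithmic factor positive where f is 1. *)
Definition soft_O (A : Type) (T f : A -> nat) : Prop :=
  exists C k : nat, forall x : A,
    T x <= C * (f x * (trunc_log 2 (f x)).+1 ^ k).

(* Main.v *)
From mathcomp Require Import all_boot all_order all_algebra.
From mathcomp Require Import zify.
Require Import Defs.

(* Whichever way c copies of a job are distributed over the m machines, at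
   least (c - (m - 1)) / 2 pairs of copies stay together on one machine.  So
   (c - (m - 1)) / 2 pairs may be glued together, leaving at most m single
   copies; iterating this, a schedule amounts to distributing, for each level
   k = 0, 1, ..., log n and each of the p_max + 1 job sizes, at most m bundles
   of 2 ^ k equal jobs.  For given upper bounds on the load and on the number of
   jobs of each machine, the levels are processed from k = 0 upwards, halving
   (rounding down) what is left of the bounds after each level.  Before level k,
   each bound has dropped below its initial value divided by 2 ^ k by only
   O(p_max ^ 2), hence a dynamic program over the vectors of the 2m drops has
   O(p_max ^ (4m)) states for each of the O(p_max log n) bundles.  An optimal
   makespan is w / q_i with w <= n p_max, where i is the busiest machine; it is
   found by a binary search over w for each i. *)

(** A remaining bound can be as large as [n * p_max], too large for a table index. What keeps the
    table small is that [budget %/ 2 ^ k] is determined by the level alone, so only the distance to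
    it has to be stored. This distance is stable under the passage to the next level: with B =
    [nslots * p.+1], a level starts with a drop of at most B + 1, its slots add at most B, and half
    of 2 * B + 1, rounded up, is B + 1 again. Rounding the bounds down costs nothing, since once the
    single bundles of a level are placed, all that remains has even load and even number in the
    current unit. Working with upper bounds instead of exact loads makes feasibility monotone in the
    makespan, which the bisection needs. On the machine side the difficulty is overflow: registers
    and cells stay at most X, a polynomial in the input magnitude, and intermediate values stay
    below a power of X whose exponent depends only on the program text. *)

Set Implicit Arguments.
Unset Strict Implicit.
Unset Printing Implicit Defensive.

(* [lia] does not identify two sums whose index types are only convertible. *)
Ltac gen_sums := repeat match goal with
  |- context [@bigop.body ?a ?b ?c ?d ?e] => move: (@bigop.body a b c d e) => ?
  end.

(** * Splitting a schedule into bundles *)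

Section Splitting.

(** The terms subtract the full [f i'] of the earlier indices, not the amounts these received; with
    truncated subtraction both leave the same remainder of [v]. *)
Lemma sum_greedy (f : nat -> nat) v m :
  \sum_(i < m) minn (f i) (v - \sum_(i' < i) f i') = minn v (\sum_(i < m) f i).
Proof.
elim: m => [|m IH]; first by rewrite !big_ord0 minn0.
rewrite !big_ord_recr /= IH.
by gen_sums; lia.
Qed.

Lemma sum_half_ge (a : nat -> nat) m :
  \sum_(i < m) a i <= 2 * \sum_(i < m) a i %/ 2 + m.
Proof.
elim: m => [|m IH]; first by rewrite !big_ord0.
rewrite !big_ord_recr /=. by move: IH; gen_sums; lia.
Qed.

(** Parity costs at most one unit per machine, so the halves add up to at least (x - m) / 2 rounded
    up, which is [(x - (m - 1)) %/ 2]. The greedy choice [b] stops exactly there. *)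
Lemma half_split (a : nat -> nat) m x :
  \sum_(i < m) a i = x ->
  let b i := minn (a i %/ 2) ((x - (m - 1)) %/ 2 - \sum_(i' < i) a i' %/ 2) in
  (forall i, 2 * b i <= a i) /\ \sum_(i < m) b i = (x - (m - 1)) %/ 2.
Proof.
move=> ax b; split=> [i|]; first by rewrite /b; lia.
by rewrite (sum_greedy (fun i => a i %/ 2)); have := sum_half_ge a m; rewrite ax; gen_sums; lia.
Qed.

End Splitting.

(** * Bundle counts per level, and completing a partial distribution of bundles *)

Section Levels.
Variables (m p : nat) (c : nat -> nat).
Hypothesis m_gt0 : 0 < m.

(* The closed form of iterating k times mu |-> (mu - (m - 1)) / 2 from c t. *)
Definition cnt k t := (c t + (m - 1)) %/ 2 ^ k - (m - 1).
(** The bundles of level [k] that stay single after [cnt k.+1 t] pairs have been glued. *)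
Definition rho k t := cnt k t - 2 * cnt k.+1 t.
(* The slots of a level are numbered t * m + j with j < m; the slot is occupied
   by a bundle of jobs of size t when j < rho k t.  These are the occupied ones
   from number q on. *)
Definition rest k q t := rho k t - (q - t * m).

(** Shifting by m - 1 turns the recursion into plain halving: (v - 2 * (m - 1)) / 2 = v / 2 - (m -
    1), also when the subtractions truncate. *)
Lemma cntS k t : cnt k.+1 t = (cnt k t - (m - 1)) %/ 2.
Proof. by rewrite /cnt expnSr divnMA; lia. Qed.

Lemma cnt0 t : cnt 0 t = c t.
Proof. by rewrite /cnt expn0 divn1; lia. Qed.

(** Here c t + (m - 1) < m * 2 ^ k, so the quotient is at most m - 1. *)
Lemma cnt_eq0 k t : c t < 2 ^ k -> cnt k t = 0.
Proof.
move=> ck; rewrite /cnt; apply/eqP; rewrite subn_eq0.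
rewrite -ltnS ltn_divLR; nia.
Qed.

Lemma cnt_rho k t : rho k t + 2 * cnt k.+1 t = cnt k t.
Proof. by rewrite /rho cntS; lia. Qed.

(** Halving [cnt k t - (m - 1)] loses at most one unit, on top of the m - 1 set aside. Hence m slots
    per size and level suffice. *)
Lemma rho_le k t : rho k t <= m.
Proof. by rewrite /rho cntS; lia. Qed.

Lemma rest0 k t : rest k 0 t = rho k t.
Proof. by rewrite /rest; lia. Qed.

Lemma rest_end k t : t < p.+1 -> rest k (p.+1 * m) t = 0.
Proof. by move=> tp; have := rho_le k t; rewrite /rest; nia. Qed.

Lemma restS k q t :
  rest k q t = ((t == q %/ m) && (q %% m < rho k t)) + rest k q.+1 t.
Proof.
rewrite /rest; have := rho_le k t; have := ltn_pmod q m_gt0.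
have := divn_eq q m; set a := q %/ m; set b := q %% m => -> bm rm.
have [->|ta] := eqVneq t a; first by case: ltnP => /=; lia.
have [lta|lat] : t < a \/ a < t by lia.
  by rewrite /=; nia.
by rewrite /=; nia.
Qed.

(* u bounds the load of machine i by u i and its number of jobs by u (m + i). *)
Definition within (z : nat -> nat -> nat) (u : nat -> nat) :=
  forall i, i < m -> \sum_(t < p.+1) t * z i t <= u i /\
                     \sum_(t < p.+1) z i t <= u (m + i).

Definition splittable (mu u : nat -> nat) :=
  exists2 z : nat -> nat -> nat,
    forall t, t < p.+1 -> \sum_(i < m) z i t = mu t & within z u.

(* Loads are in units of 2 ^ k: x distributes the bundles of level k from slot q
   on, y those of the higher levels. *)
Definition completable k q (u : nat -> nat) :=
  exists x y : nat -> nat -> nat,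
    [/\ forall t, t < p.+1 -> \sum_(i < m) x i t = rest k q t,
        forall t, t < p.+1 -> \sum_(i < m) y i t = cnt k.+1 t
      & within (fun i t => x i t + 2 * y i t) u].

Lemma within_le z z' u u' :
  (forall i t, i < m -> t < p.+1 -> z' i t <= z i t) ->
  (forall j, j < 2 * m -> u j <= u' j) ->
  within z u -> within z' u'.
Proof.
move=> le_z le_u zu i im; have [h1 h2] := zu i im; split.
  apply: leq_trans (leq_trans h1 (le_u _ _)); last by lia.
  by apply: leq_sum => t _; rewrite leq_mul2l le_z ?orbT.
apply: leq_trans (leq_trans h2 (le_u _ _)); last by lia.
by apply: leq_sum => t _; rewrite le_z.
Qed.

Lemma splittable_le mu u u' :
  (forall j, j < 2 * m -> u j <= u' j) -> splittable mu u -> splittable mu u'.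
Proof. by move=> le [z zm zu]; exists z => //; apply: within_le zu. Qed.

Lemma completable_eq k q u u' :
  (forall j, j < 2 * m -> u j = u' j) -> completable k q u -> completable k q u'.
Proof.
move=> e [x [y [xr yc w]]]; exists x, y; split=> //.
by apply: within_le w => // j jm; rewrite e.
Qed.

(** The structural step: in any distribution [z] of the bundles of level [k], [half_split] finds,
    for each size separately, the prescribed number of pairs lying together on a machine. They form
    [y], and what is left is [x]. *)
Lemma completable0 k u : completable k 0 u <-> splittable (cnt k) u.
Proof.
split=> [[x [y [xr yc w]]]|[z zc w]].
  exists (fun i t => x i t + 2 * y i t) => // t tp.
  by rewrite big_split -big_distrr /= xr // yc // rest0 cnt_rho.
pose y i t := minn (z i t %/ 2)
   ((cnt k t - (m - 1)) %/ 2 - \sum_(i' < i) z i' t %/ 2).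
have yP t : t < p.+1 ->
    (forall i, 2 * y i t <= z i t) /\ \sum_(i < m) y i t = cnt k.+1 t.
  by move=> tp; rewrite cntS; apply: (half_split (a := z^~ t)); apply: zc.
exists (fun i t => z i t - 2 * y i t), y; split=> [t tp|t tp|].
- rewrite rest0 sumnB => [|i _]; last by case: (yP t tp).
  by rewrite zc // -big_distrr /= (yP t tp).2.
- exact: (yP t tp).2.
- apply: within_le w => // i t im tp.
  by have := (yP t tp).1 i; lia.
Qed.

Lemma completable_last k u :
  (forall t, t < p.+1 -> c t < 2 ^ k) -> completable k 0 u.
Proof.
move=> ck; apply/completable0; exists (fun _ _ => 0).
  by move=> t tp; rewrite cnt_eq0 ?ck // big1.
by move=> i im; rewrite !big1 // => t _; rewrite muln0.
Qed.

(** Past the last slot only doubled bundles remain, and 2 * s <= u is equivalent to s <= u / 2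
    rounded down. *)
Lemma completable_halve k u :
  completable k (p.+1 * m) u <-> completable k.+1 0 (fun j => u j %/ 2).
Proof.
have sum2 (z : nat -> nat -> nat) i :
    \sum_(t < p.+1) t * (2 * z i t) = 2 * \sum_(t < p.+1) t * z i t.
  by rewrite big_distrr /=; apply: eq_bigr => t _; lia.
rewrite completable0; split=> [[x [y [xr yc w]]]|[y yc w]].
  exists y => // i im.
  have /(_ i im)[] : within (fun i t => 2 * y i t) u.
    by apply: within_le w => // i' t _ _; lia.
  by rewrite sum2 -big_distrr /=; lia.
exists (fun _ _ => 0), y; split=> // [t tp|i im].
  by rewrite rest_end // big1.
suff: \sum_(t < p.+1) t * (2 * y i t) <= u i /\
  \sum_(t < p.+1) 2 * y i t <= u (m + i) by [].
by have [] := w i im; rewrite sum2 -big_distrr /=; gen_sums; lia.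
Qed.

Lemma completable_skip k q u :
  ~~ (q %% m < rho k (q %/ m)) -> completable k q u <-> completable k q.+1 u.
Proof.
move=> nq; have e t : rest k q t = rest k q.+1 t.
  by rewrite restS; case: eqP => [->|//]; rewrite (negbTE nq).
by split=> -[x [y [xr yc w]]]; exists x, y; split=> // t tp; rewrite xr.
Qed.

Definition use i t (u : nat -> nat) j := u j - (j == i) * t - (j == m + i).

Lemma sum_delta i a n : i < n -> \sum_(t < n) (t == i :> nat) * a = a.
Proof.
move=> lt; rewrite (bigD1 (Ordinal lt)) //= eqxx mul1n big1 ?addn0 // => j.
by rewrite -val_eqE /= => /negbTE->.
Qed.

(** The recurrence of the dynamic program. Bundles of equal size are interchangeable, so the one in
    slot [q] may be taken to be any bundle of its size in the completion. *)
Lemma completable_item k q u : q < p.+1 * m ->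
  q %% m < rho k (q %/ m) ->
  completable k q u <->
  exists i, [/\ i < m, q %/ m <= u i, 0 < u (m + i)
              & completable k q.+1 (use i (q %/ m) u)].
Proof.
move=> qm qr; set t0 := q %/ m.
have t0p : t0 < p.+1 by rewrite /t0 ltn_divLR.
have e t : rest k q t = (t == t0) + rest k q.+1 t.
  by rewrite restS; case: eqP => [->|//]; rewrite qr.
pose dl (i i' t : nat) : nat := (i' == i) && (t == t0).
have dl1 i i' : \sum_(t < p.+1) t * dl i i' t = (i' == i) * t0.
  rewrite -[RHS](sum_delta _ t0p); apply: eq_bigr => t _.
  by rewrite /dl; case: (i' == i); case: eqP => /= [->|_]; lia.
have dl2 i i' : \sum_(t < p.+1) dl i i' t = (i' == i).
  rewrite -[RHS](sum_delta _ t0p); apply: eq_bigr => t _.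
  by rewrite /dl mulnb andbC.
have dl3 i t : i < m -> \sum_(i' < m) dl i i' t = (t == t0).
  move=> im; rewrite -[RHS](sum_delta _ im); apply: eq_bigr => i' _.
  by rewrite /dl mulnb.
split=> [[x [y [xr yc w]]]|[i [im ti ui [x [y [xr yc w]]]]]].
  (* Slot [q] is occupied, so the multiplicities of size [t0] have a positive sum and some machine
     holds such a bundle. *)
  have [i0 xi0] : exists i : 'I_m, 0 < x i t0.
    apply/existsP; apply: contraLR isT => /existsPn x0.
    have := xr t0 t0p; rewrite e eqxx big1 // => i _.
    by have := x0 i; rewrite lt0n negbK => /eqP.
  have x_dl i t : x i t = dl i0 i t + (x i t - dl i0 i t).
    by rewrite /dl; case: eqP => /= [->|_]; last lia; case: eqP => /= [->|_]; lia.
  exists i0; have w' i : i < m ->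
      (i == i0 :> nat) * t0 + \sum_(t < p.+1) t * (x i t - dl i0 i t + 2 * y i t) <= u i /\
      (i == i0 :> nat) + \sum_(t < p.+1) (x i t - dl i0 i t + 2 * y i t) <= u (m + i).
    move=> im; have [h1 h2] := w i im; split.
      apply: leq_trans h1; rewrite -dl1 -big_split /=; apply: leq_sum => t _.
      by have := x_dl i t; nia.
    apply: leq_trans h2; rewrite -dl2 -big_split /=; apply: leq_sum => t _.
    by have := x_dl i t; lia.
  have := w' i0 (ltn_ord i0); rewrite eqxx => -[h1 h2].
  split=> //; [lia|lia|].
  exists (fun i t => x i t - dl i0 i t), y; split=> // [t tp|i im].
    have := xr t tp; rewrite (eq_bigr _ (fun (i : 'I_m) _ => x_dl i t)) big_split /=.
    by rewrite dl3 // e; lia.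
  have [] := w' i im; rewrite /use eqn_add2l.
  have -> : (i == m + i0) = false by have := ltn_ord i0; lia.
  have -> : (m + i == i0) = false by have := ltn_ord i0; lia.
  by lia.
exists (fun i' t => x i' t + dl i i' t), y; split=> // [t tp|i' im'].
  by rewrite big_split /= xr // dl3 // e; lia.
have [] := w i' im'; rewrite /use eqn_add2l.
have -> : (i' == m + i) = false by lia.
have -> : (m + i' == i) = false by lia.
have -> : \sum_(t < p.+1) t * (x i' t + dl i i' t + 2 * y i' t) =
   (i' == i) * t0 + \sum_(t < p.+1) t * (x i' t + 2 * y i' t).
  by rewrite -dl1 -big_split /=; apply: eq_bigr => t _; lia.
have -> : \sum_(t < p.+1) (x i' t + dl i i' t + 2 * y i' t) =
   (i' == i) + \sum_(t < p.+1) (x i' t + 2 * y i' t).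
  by rewrite -dl2 -big_split /=; apply: eq_bigr => t _; lia.
by case: eqP => [->|_]; lia.
Qed.

End Levels.

(** * Reasoning about RAM programs *)

(** An exponent bounding the value of [e] by a power of X. A constant is charged its own value, as c
    < 2 ^ c; a [Read] yields a cell, hence at most X, so only its address counts. *)
Fixpoint expr_size e :=
  match e with
  | Const c => c.+1
  | Reg _ => 1
  | Read a => expr_size a
  | Bin _ e1 e2 => expr_size e1 + expr_size e2
  end.

Fixpoint max_expr_size c :=
  match c with
  | Skip => 0
  | Assign _ e => expr_size e
  | Write a e => maxn (expr_size a) (expr_size e)
  | Seq c1 c2 => maxn (max_expr_size c1) (max_expr_size c2)
  | If e c1 c2 =>
      maxn (expr_size e) (maxn (max_expr_size c1) (max_expr_size c2))
  | While e c => maxn (expr_size e) (max_expr_size c)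
  end.

(* Meaningful only for commands without loops. *)
Fixpoint max_cost c :=
  match c with
  | Skip => 1
  | Assign _ e => (cost e).+1
  | Write a e => (cost a + cost e).+1
  | Seq c1 c2 => max_cost c1 + max_cost c2
  | If e c1 c2 => (cost e).+1 + (max_cost c1 + max_cost c2)
  | While _ _ => 0
  end.

Arguments max_cost : simpl never.

Section Logic.
Variable X : nat.
Hypothesis X_ge2 : 1 < X.

Definition bounded s := (forall x, regs s x <= X) /\ (forall a, mem s a <= X).

Lemma expr_size_gt0 e : 0 < expr_size e.
Proof. by elim: e => //= o e1 h1 e2 h2; lia. Qed.

(** Both operand bounds are at least 2, so their product dominates the sum as well as the product of
    the operands. *)
Lemma eval_le s e : bounded s -> eval s e <= X ^ expr_size e.
Proof.
move=> [bR bM].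
have X1 f : 2 <= X ^ expr_size f.
  apply: leq_trans X_ge2 _; rewrite -{1}[X]expn1 leq_exp2l //.
  exact: expr_size_gt0.
elim: e => [c|x|a _|o e1 IH1 e2 IH2] /=.
- by apply: leq_trans (ltnW (ltn_expl c X_ge2)) _; rewrite leq_exp2l.
- by rewrite expn1.
- by apply: leq_trans (bM _) _; rewrite -{1}[X]expn1 leq_exp2l ?expr_size_gt0.
- have := X1 e1; have := X1 e2; rewrite expnD.
  move: (leq_div (eval s e1) (eval s e2)) (leq_mod (eval s e1) (eval s e2)).
  by case: o => /=; nia.
Qed.

Lemma fits_bounded s G e : bounded s -> expr_size e <= G -> fits (X ^ G) s e.
Proof.
move=> bs; have evG e' : expr_size e' <= G -> eval s e' <= X ^ G.
  by move=> le; apply: leq_trans (eval_le _ bs) _; rewrite leq_exp2l.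
elim: e => [c|x|a IH|o e1 IH1 e2 IH2] le; have := evG _ le => /= -> //=.
  exact: IH.
by apply/andP; split; [apply: IH1 | apply: IH2]; move: le => /=; lia.
Qed.

(* The word bound X ^ G depends only on the size of the expressions, so keeping
   all registers and cells at most X rules out overflows. *)
Definition runs c s T (Q : state -> Prop) :=
  bounded s -> exists t s',
    [/\ forall G, max_expr_size c <= G -> exec (X ^ G) c s t s',
        t <= T, bounded s' & Q s'].

Lemma runs_weaken c s T T' (Q Q' : state -> Prop) :
  runs c s T Q -> T <= T' -> (forall s', Q s' -> Q' s') -> runs c s T' Q'.
Proof.
move=> rc TT QQ bs; have [t [s' [e tT bs' q]]] := rc bs.
by exists t, s'; split=> //; [apply: leq_trans TT | apply: QQ].
Qed.

Lemma runs_post c s T (Q Q' : state -> Prop) :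
  runs c s T Q -> (forall s', Q s' -> Q' s') -> runs c s T Q'.
Proof. by move=> rc; apply: runs_weaken rc _. Qed.

Lemma runs_bounded c s T Q : (bounded s -> runs c s T Q) -> runs c s T Q.
Proof. by move=> h bs; apply: h. Qed.

Lemma runs_skip s (Q : state -> Prop) : Q s -> runs Skip s (max_cost Skip) Q.
Proof. by move=> q bs; exists 1, s; split=> // G _; constructor. Qed.

Lemma runs_assign x e s (Q : state -> Prop) :
  eval s e <= X ->
  Q (State (update (regs s) x (eval s e)) (mem s)) ->
  runs (Assign x e) s (max_cost (Assign x e)) Q.
Proof.
move=> le q bs; eexists _, _; split; [|exact: leqnn|split|exact: q].
- by move=> G /= eG; constructor; apply: fits_bounded.
- by move=> y /=; rewrite /update; case: eqP => // _; apply: bs.1.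
- exact: bs.2.
Qed.

Lemma runs_write a e s (Q : state -> Prop) :
  eval s e <= X ->
  Q (State (regs s) (update (mem s) (eval s a) (eval s e))) ->
  runs (Write a e) s (max_cost (Write a e)) Q.
Proof.
move=> le q bs; eexists _, _; split; [|exact: leqnn|split|exact: q].
- by move=> G /=; rewrite geq_max => /andP[aG eG]; constructor; apply: fits_bounded.
- exact: bs.1.
- by move=> y /=; rewrite /update; case: eqP => // _; apply: bs.2.
Qed.

Lemma runs_seq c1 c2 s T1 T2 Q :
  runs c1 s T1 (fun s' => runs c2 s' T2 Q) -> runs (Seq c1 c2) s (T1 + T2) Q.
Proof.
move=> h bs; have [t1 [s1 [e1 l1 b1 h2]]] := h bs.
have [t2 [s2 [e2 l2 b2 q]]] := h2 b1.
exists (t1 + t2), s2; split=> // [G /=|]; last exact: leq_add.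
by rewrite geq_max => /andP[g1 g2]; apply: ExecSeq (e1 _ g1) (e2 _ g2).
Qed.

Lemma runs_seq_max c1 c2 s Q :
  runs c1 s (max_cost c1) (fun s' => runs c2 s' (max_cost c2) Q) ->
  runs (Seq c1 c2) s (max_cost (Seq c1 c2)) Q.
Proof. exact: runs_seq. Qed.

Lemma runs_if e c1 c2 s T Q :
  (eval s e <> 0 -> runs c1 s T Q) -> (eval s e = 0 -> runs c2 s T Q) ->
  runs (If e c1 c2) s ((cost e).+1 + T) Q.
Proof.
move=> h1 h2 bs; have [e0|/eqP e1] := eqVneq (eval s e) 0.
  have [t [s' [x l b q]]] := h2 e0 bs.
  exists ((cost e).+1 + t), s'; split=> // [G /=|]; last by rewrite leq_add2l.
  rewrite !geq_max => /and3P[ge g1 g2].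
  by apply: ExecIfFalse; [apply: fits_bounded | | apply: x].
have [t [s' [x l b q]]] := h1 e1 bs.
exists ((cost e).+1 + t), s'; split=> // [G /=|]; last by rewrite leq_add2l.
rewrite !geq_max => /and3P[ge g1 g2].
by apply: ExecIfTrue; [apply: fits_bounded | apply/eqP | apply: x].
Qed.

Lemma runs_if_max e c1 c2 s Q :
  (eval s e <> 0 -> runs c1 s (max_cost c1) Q) ->
  (eval s e = 0 -> runs c2 s (max_cost c2) Q) ->
  runs (If e c1 c2) s (max_cost (If e c1 c2)) Q.
Proof.
move=> h1 h2; apply: runs_if => ev.
  by apply: runs_weaken (h1 ev) _ _ => //; rewrite leq_addr.
by apply: runs_weaken (h2 ev) _ _ => //; rewrite leq_addl.
Qed.

(** The index of [Inv] is a variant that each round lowers by one; the extra round in [N.+1] pays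
    for the last, failing test. *)
Lemma runs_while e c (Inv : nat -> state -> Prop) (Q : state -> Prop) T N s :
  (forall r s', Inv r s' -> eval s' e <> 0 ->
     exists2 r', r = r'.+1 & runs c s' T (Inv r')) ->
  (forall r s', Inv r s' -> eval s' e = 0 -> Q s') ->
  Inv N s -> runs (While e c) s (N.+1 * (T + (cost e).+1)) Q.
Proof.
move=> body done; elim: N s => [|N IH] s inv bs;
    have [e0|/eqP e1] := eqVneq (eval s e) 0.
- exists (cost e).+1, s; split=> //; last exact: done inv e0.
    by move=> G /=; rewrite geq_max => /andP[ge gc]; apply: ExecWhileFalse;
       rewrite ?fits_bounded.
  by rewrite mul1n leq_addl.
- by have [] := body _ _ inv e1.
- exists (cost e).+1, s; split=> //; last exact: done inv e0.
    by move=> G /=; rewrite geq_max => /andP[ge gc]; apply: ExecWhileFalse;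
       rewrite ?fits_bounded.
  by rewrite mulSn; lia.
have [r' [<-] h] := body _ _ inv e1.
have [t1 [s1 [x1 l1 b1 i1]]] := h bs.
have [t2 [s2 [x2 l2 b2 i2]]] := IH _ i1 b1.
exists ((cost e).+1 + t1 + t2), s2; split=> //; last by rewrite mulSn; lia.
move=> G g; have := g; rewrite /= geq_max => /andP[ge gc].
by apply: ExecWhileTrue (x1 _ gc) (x2 _ g); [apply: fits_bounded | apply/eqP].
Qed.

End Logic.

(** * Vectors of drops as numbers in base [A] *)

Section Encoding.
Variable A : nat.

Definition enc (d : nat -> nat) n := \sum_(j < n) d j * A ^ j.

Lemma enc_lt d n : (forall j, j < n -> d j < A) -> enc d n < A ^ n.
Proof.
rewrite /enc; elim: n => [|n IH] dA; first by rewrite big_ord0.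
rewrite big_ord_recr /= expnS; have := IH (fun j jn => dA j (ltnW jn)).
by have := dA n (leqnn _); gen_sums; move: (A ^ n) => B; nia.
Qed.

Lemma enc_digit d n j :
  (forall j, j < n -> d j < A) -> j < n -> enc d n %/ A ^ j %% A = d j.
Proof.
elim: n => // n IH dA; rewrite ltnS leq_eqVlt /enc big_ord_recr /= -/(enc d n).
have lt := enc_lt (fun j jn => dA j (ltnW jn)).
have A0 : 0 < A by have := dA n (leqnn _); lia.
case/predU1P=> [->|jn].
  by rewrite addnC divnMDl ?expn_gt0 ?A0 // divn_small // addn0 modn_small ?dA.
have -> : A ^ n = A ^ (n - j.+1) * A * A ^ j.
  by rewrite -expnSr -expnD; congr (_ ^ _); lia.
rewrite addnC mulnA divnMDl ?expn_gt0 ?A0 // mulnA modnMDl.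
by apply: IH => // i i_n; apply: dA; apply: ltnW.
Qed.

(** [enc] is linear in the digits, so placing a bundle is an addition on the code, without
    decoding. *)
Lemma enc_add d n i i' t : i < n -> i' < n ->
  enc (fun j => d j + (j == i) * t + (j == i')) n =
  enc d n + t * A ^ i + A ^ i'.
Proof.
move=> i_n i'_n; rewrite /enc -(sum_delta (t * A ^ i) i_n) -(sum_delta (A ^ i') i'_n).
rewrite -!big_split /=; apply: eq_bigr => j _; rewrite !mulnDl.
by case: eqP => [->|_]; case: eqP => [->|_]; rewrite /=; lia.
Qed.

End Encoding.

(** * The program *)

Notation "a [+] b" := (Bin Add a b) (at level 50, left associativity).
Notation "a [-] b" := (Bin Sub a b) (at level 50, left associativity).
Notation "a [*] b" := (Bin Mul a b) (at level 40, left associativity).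
Notation "a [/] b" := (Bin Div a b) (at level 40, left associativity).
Notation "a [mod] b" := (Bin Mod a b) (at level 40, left associativity).
Notation "a [<] b" := (Bin Lt a b) (at level 70, no associativity).
Notation "a [=] b" := (Bin Eq a b) (at level 70, no associativity).
Notation "x ::= e" := (Assign x e) (at level 80, no associativity).
Notation "c1 ;; c2" := (Seq c1 c2) (at level 85, right associativity).

Notation r_n := 0 (only parsing).
Notation r_p := 1 (only parsing).
Notation r_off := 2 (only parsing).
Notation r_K := 3 (only parsing).
Notation r_A := 4 (only parsing).
Notation r_S := 5 (only parsing).
Notation r_M := 6 (only parsing).
Notation r_N := 7 (only parsing).
Notation r_lo := 8 (only parsing).
Notation r_hi := 9 (only parsing).
Notation r_bnum := 10 (only parsing).
Notation r_bden := 11 (only parsing).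
Notation r_num := 12 (only parsing).
Notation r_den := 13 (only parsing).
Notation r_g := 20 (only parsing).
Notation r_k := 21 (only parsing).
Notation r_q := 22 (only parsing).
Notation r_s := 23 (only parsing).
Notation r_v := 24 (only parsing).
Notation r_t := 25 (only parsing).
Notation r_j := 26 (only parsing).
Notation r_U i := (30 + i) (only parsing).

Notation a_proc := 0 (only parsing).
Notation a_count := 1 (only parsing).
Notation a_pow := 2 (only parsing).
Notation a_table := 3 (only parsing).
Notation a_mult i := (4 + i) (only parsing).

Section Program.
Variable m : nat.

(* m + 4 arrays of unbounded length, interleaved so that they never overlap. *)
Definition addr off r i := off + ((m + 4) * i + r).

Definition addrE r e := Reg r_off [+] (Const (m + 4) [*] e [+] Const r).
Definition get r e := Read (addrE r e).
Definition put r e v := Write (addrE r e) v.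

Fixpoint powE e i := if i is i'.+1 then e [*] powE e i' else Const 1.
Fixpoint sumE f n := if n is n'.+1 then sumE f n' [+] f n' else Const 0.

Definition digitE j := Reg r_s [/] powE (Reg r_A) j [mod] Reg r_A.
(** The load bounds change with each tested makespan and live in registers; the bounds on the number
    of jobs are the capacities, read from their input cells. *)
Definition budgetE j :=
  if j < m then Reg (r_U j) else Read (Const (3 * (j - m) + 3)).
Definition levelE j k := budgetE j [/] get a_pow k.
Definition cntE k t :=
  (get a_count t [+] Const (m - 1)) [/] get a_pow k [-] Const (m - 1).
Definition presentE :=
  Reg r_q [mod] Const m [<]
  cntE (Reg r_k) (Reg r_t) [-] Const 2 [*] cntE (Reg r_k [+] Const 1) (Reg r_t).

(** Re-encodes every digit: the new drop is measured against the bound of level k + 1. *)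
Definition halveE := sumE (fun j =>
  (levelE j (Reg r_k [+] Const 1) [-]
   (levelE j (Reg r_k) [-] digitE j) [/] Const 2) [*] powE (Reg r_A) j) (2 * m).
(** The row past the last slot of a level is directly followed by slot 0 of the next level, so every
    transition advances by exactly one row. *)
Definition goto_halveE := Reg r_g [-] Reg r_s [+] Reg r_S [+] halveE.
Definition goto_skipE := Reg r_g [+] Reg r_S.
Definition goto_itemE i :=
  Reg r_g [+] Reg r_S [+] Reg r_t [*] powE (Reg r_A) i [+] powE (Reg r_A) (m + i).
(** A conjunction written as a product. Testing t + d < bound + 1 instead of t <= bound - d avoids
    truncated subtraction. *)
Definition can_pickE i :=
  (Reg r_t [+] digitE i [<] levelE i (Reg r_k) [+] Const 1) [*]
  (digitE (m + i) [<] levelE (m + i) (Reg r_k)) [*]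
  get a_table (goto_itemE i).

Fixpoint first_of (test : nat -> expr) (act : nat -> cmd) fail l :=
  if l is i :: l' then If (test i) (act i) (first_of test act fail l') else fail.

Definition decode :=
  r_s ::= Reg r_g [mod] Reg r_S ;;
  r_k ::= Reg r_g [/] Reg r_S [/] Reg r_M ;;
  r_q ::= Reg r_g [/] Reg r_S [mod] Reg r_M ;;
  r_t ::= Reg r_q [/] Const m.

(** One case distinction serves both passes: when filling the table, [goto] reads the successor
    cell; when walking, it moves there and [pick] records the bundle. *)
Definition step (goto : expr -> cmd) (pick : nat -> cmd) fail :=
  If (Reg r_q [=] Reg r_M [-] Const 1) (goto goto_halveE)
    (If presentE
       (first_of can_pickE (fun i => pick i ;; goto (goto_itemE i)) fail
          (iota 0 m))
       (goto goto_skipE)).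

Definition eval_cell :=
  If (Reg r_k [=] Reg r_K) (r_v ::= Const 1)
    (step (fun e => r_v ::= get a_table e) (fun=> Skip) (r_v ::= Const 0)).

Definition fill_cell :=
  r_g ::= Reg r_g [-] Const 1 ;;
  decode ;;
  eval_cell ;;
  put a_table (Reg r_g) (Reg r_v).

Fixpoint set_budgets l :=
  if l is i :: l' then
    r_U i ::= (Reg r_num [*] Read (Const (3 * i + 1))) [/]
              (Reg r_den [*] Read (Const (3 * i + 2))) ;;
    set_budgets l'
  else Skip.

Definition decide :=
  set_budgets (iota 0 m) ;;
  r_g ::= (Reg r_N [+] Const 1) [*] Reg r_S ;;
  While (Reg r_g) fill_cell.

Definition walk_cell :=
  decode ;;
  step (fun e => r_g ::= e)
    (fun i => put (a_mult i) (Reg r_t)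
                (get (a_mult i) (Reg r_t) [+] get a_pow (Reg r_k)))
    Skip.

Definition walk :=
  r_g ::= Const 0 ;;
  While (Reg r_g [<] Reg r_N [*] Reg r_S) walk_cell.

(* Tests the makespan w / q_a, where w is the midpoint of the current bracket. *)
Definition probe a :=
  r_num ::= (Reg r_lo [+] Reg r_hi) [/] Const 2 [*] Read (Const (3 * a + 2)) ;;
  r_den ::= Read (Const (3 * a + 1)) ;;
  decide ;;
  If (get a_table (Const 0))
    (r_hi ::= (Reg r_lo [+] Reg r_hi) [/] Const 2 ;;
     If (Reg r_num [*] Reg r_bden [<] Reg r_bnum [*] Reg r_den)
       (r_bnum ::= Reg r_num ;; r_bden ::= Reg r_den) Skip)
    (r_lo ::= (Reg r_lo [+] Reg r_hi) [/] Const 2 [+] Const 1).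

(** [r_hi] starts at n * p + 1, one more than any total work, as a mark that nothing achievable has
    been found on this machine. The best fraction is kept across machines. *)
Fixpoint search l :=
  if l is a :: l' then
    r_lo ::= Const 0 ;;
    r_hi ::= Reg r_n [*] Reg r_p [+] Const 1 ;;
    While (Reg r_lo [<] Reg r_hi) (probe a) ;;
    search l'
  else Skip.

(** The sizes are copied to [a_proc] because the output is later written over the input cells. *)
Definition read_job :=
  r_t ::= Read (Const (3 * m + 1) [+] Reg r_j) ;;
  put a_proc (Reg r_j) (Reg r_t) ;;
  put a_count (Reg r_t) (get a_count (Reg r_t) [+] Const 1) ;;
  If (Reg r_p [<] Reg r_t) (r_p ::= Reg r_t) Skip ;;
  r_j ::= Reg r_j [+] Const 1.

Definition read_input :=
  r_n ::= Read (Const 0) ;;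
  r_off ::= Reg r_n [+] Const (3 * m + 1) ;;
  While (Reg r_j [<] Reg r_n) read_job.

Definition next_pow :=
  r_v ::= Reg r_v [*] Const 2 ;;
  r_K ::= Reg r_K [+] Const 1 ;;
  put a_pow (Reg r_K) (Reg r_v).

Definition set_constants :=
  r_v ::= Const 1 ;;
  put a_pow (Const 0) (Const 1) ;;
  While (Reg r_v [<] Reg r_n [+] Const 1) next_pow ;;
  r_M ::= (Reg r_p [+] Const 1) [*] Const m [+] Const 1 ;;
  r_A ::= Const 2 [*] ((Reg r_M [-] Const 1) [*] (Reg r_p [+] Const 1)) [+] Const 2 ;;
  r_S ::= powE (Reg r_A) (2 * m) ;;
  r_N ::= Reg r_K [*] Reg r_M ;;
  r_bnum ::= Const 1.

Definition output_job :=
  r_t ::= get a_proc (Reg r_j) ;;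
  first_of (fun i => get (a_mult i) (Reg r_t))
    (fun i =>
       put (a_mult i) (Reg r_t) (get (a_mult i) (Reg r_t) [-] Const 1) ;;
       Write (Reg r_j [+] Const 1) (Const i)) Skip (iota 0 m) ;;
  r_j ::= Reg r_j [+] Const 1.

Definition output :=
  r_j ::= Const 0 ;;
  While (Reg r_j [<] Reg r_n) output_job ;;
  Write (Const 0) (Const 1).

(** A zero [r_bden] means that no makespan is achievable. Otherwise [decide] has to be run again for
    the best one, since later probes have overwritten the table. *)
Definition solve :=
  read_input ;;
  set_constants ;;
  search (iota 0 m) ;;
  If (Reg r_bden)
    (r_num ::= Reg r_bnum ;; r_den ::= Reg r_bden ;; decide ;; walk ;; output)
    (Write (Const 0) (Const 0)).

End Program.

Lemma updateE f a v x : update f a v x = if x == a then v else f x.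
Proof. by []. Qed.

Lemma eval_powE s e i : eval s (powE e i) = eval s e ^ i.
Proof. by elim: i => // i IH; rewrite expnS -IH. Qed.

Lemma eval_sumE s f k : eval s (sumE f k) = \sum_(j < k) eval s (f j).
Proof. by elim: k => [|k IH]; rewrite ?big_ord0 // big_ord_recr /= -IH. Qed.

Lemma runs_first_of X (X2 : 1 < X) test act fail l s Q :
  (forall i, i \in l -> eval s (test i) <> 0 ->
     runs X (act i) s (max_cost (act i)) Q) ->
  ((forall i, i \in l -> eval s (test i) = 0) ->
     runs X fail s (max_cost fail) Q) ->
  runs X (first_of test act fail l) s (max_cost (first_of test act fail l)) Q.
Proof.
elim: l => [|i l IH] ha hf; first exact: hf.
apply: runs_if_max => // ei; first by apply: ha; rewrite ?mem_head.
apply: IH => [i' il|el]; first by apply: ha; rewrite inE il orbT.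
by apply: hf => i'; rewrite inE => /predU1P[->|/el].
Qed.

(** * The dynamic program *)

Section Addr.
Variables m off : nat.

Lemma addr_inj r r' i i' : r < m + 4 -> r' < m + 4 ->
  (addr m off r i == addr m off r' i') = (r == r') && (i == i').
Proof.
move=> rm rm'; rewrite /addr eqn_add2l; apply/eqP/andP => [e|[/eqP-> /eqP->]//].
have := congr1 (modn^~ (m + 4)) e; rewrite !(mulnC (m + 4)) !modnMDl.
rewrite !modn_small // => er; move: e; rewrite er => e.
by split=> //; have := addn4 m; nia.
Qed.

Lemma addr_ge r i : off <= addr m off r i.
Proof. exact: leq_addr. Qed.

Lemma eval_addr s r i :
  regs s r_off = off -> regs s r_off + ((m + 4) * i + r) = addr m off r i.
Proof. by move=> ->. Qed.

Lemma eval_get s r e :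
  regs s r_off = off -> eval s (get m r e) = mem s (addr m off r (eval s e)).
Proof. by move=> ro; rewrite /= ro. Qed.

Lemma runs_put X (X2 : 1 < X) s r e v (Q : state -> Prop) :
  regs s r_off = off -> eval s v <= X ->
  Q (State (regs s) (update (mem s) (addr m off r (eval s e)) (eval s v))) ->
  runs X (put m r e v) s (max_cost (put m r e v)) Q.
Proof. by move=> ro vX q; apply: runs_write => //; rewrite /= ro. Qed.

End Addr.

Section Cells.
Variables (m n p K : nat) (P c num den cap U : nat -> nat).
Hypothesis m_gt0 : 0 < m.

Definition off := n + (3 * m + 1).
Definition nslots := p.+1 * m.
(** One more than the largest drop that [valid] allows, reached past the last slot. *)
Definition base := 2 * (nslots * p.+1) + 2.
Definition nstates := base ^ (2 * m).
Definition nrows := K * nslots.+1.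
Notation ad := (addr m off).

Record constants s : Prop := Constants {
  const_n : regs s r_n = n;
  const_p : regs s r_p = p;
  const_off : regs s r_off = off;
  const_K : regs s r_K = K;
  const_A : regs s r_A = base;
  const_S : regs s r_S = nstates;
  const_M : regs s r_M = nslots.+1;
  const_N : regs s r_N = nrows;
  const_num : forall i, i < m -> mem s (3 * i + 1) = num i;
  const_den : forall i, i < m -> mem s (3 * i + 2) = den i;
  const_cap : forall i, i < m -> mem s (3 * i + 3) = cap i;
  const_proc : forall j, j < n -> mem s (ad a_proc j) = P j;
  const_count : forall t, mem s (ad a_count t) = c t;
  const_pow : forall k, k <= K -> mem s (ad a_pow k) = 2 ^ k }.

(** Registers 20 to 29 are scratch; [arrays] lists the arrays that may have changed. *)
Definition frame (arrays : pred nat) s s' :=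
  (forall x, (x < 20) || (30 <= x) -> regs s' x = regs s x) /\
  (forall a, (forall r i, arrays r -> a <> ad r i) -> mem s' a = mem s a).

Lemma frame_trans arrays s1 s2 s3 :
  frame arrays s1 s2 -> frame arrays s2 s3 -> frame arrays s1 s3.
Proof.
by move=> [r1 m1] [r2 m2]; split=> [x h|a h]; [rewrite r2 // r1|rewrite m2 // m1].
Qed.

Lemma frame_addr (arrays : pred nat) s s' r i : frame arrays s s' ->
  (forall r', arrays r' -> 2 < r' < m + 4) -> r < m + 4 -> ~~ arrays r ->
  mem s' (ad r i) = mem s (ad r i).
Proof.
move=> [_ fm] ar rm nr; apply: fm => r' i' ar' /eqP.
rewrite addr_inj //; last by have /andP[] := ar _ ar'.
by case/andP=> /eqP e _; rewrite e ar' in nr.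
Qed.

Lemma frame_input (arrays : pred nat) s s' a : frame arrays s s' ->
  a < off -> mem s' a = mem s a.
Proof.
move=> [_ fm] lt; apply: fm => r i _ e.
by have := addr_ge m off r i; rewrite -e leqNgt lt.
Qed.

Lemma frame_constants (arrays : pred nat) s s' :
  (forall r, arrays r -> 2 < r < m + 4) ->
  frame arrays s s' -> constants s -> constants s'.
Proof.
move=> ar fr [h1 h2 h3 h4 h5 h6 h7 h8 h9 h10 h11 h12 h13 h14].
have low r i : r < 3 -> mem s' (ad r i) = mem s (ad r i).
  move=> r3; apply: (frame_addr _ fr) => //; first by lia.
  by apply/negP => /ar; lia.
have [fR _] := fr.
split; rewrite ?fR //.
- by move=> i im; rewrite (frame_input fr) ?h9 // /off; lia.
- by move=> i im; rewrite (frame_input fr) ?h10 // /off; lia.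
- by move=> i im; rewrite (frame_input fr) ?h11 // /off; lia.
- by move=> j jn; rewrite low ?h12.
- by move=> t; rewrite low ?h13.
- by move=> k kK; rewrite low ?h14.
Qed.

Definition budgets s := forall i, i < m -> regs s (r_U i) = U i.
Definition budget j := if j < m then U j else cap (j - m).
(* A table state consists of the drops d of the 2m bounds; [slack] is what is
   left of the bounds at level k. *)
Definition level k j := budget j %/ 2 ^ k.
Definition slack k (d : nat -> nat) j := level k j - d j.
Definition row k q := k * nslots.+1 + q.
Definition cell k q d := row k q * nstates + enc base d (2 * m).

(** The first bound makes the subtraction in [slack] exact; the second keeps every digit below
    [base]. *)
Definition valid k q (d : nat -> nat) := forall j, j < 2 * m ->
  d j <= level k j /\ d j <= (nslots * p.+1).+1 + q * p.+1.

Lemma valid_lt k q d j :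
  q < nslots.+1 -> valid k q d -> j < 2 * m -> d j < base.
Proof.
move=> qM v jm; have [_ h] := v j jm; apply: leq_ltn_trans h _.
have : q * p.+1 <= nslots * p.+1 by rewrite leq_mul2r orbC -ltnS qM.
by rewrite /base; lia.
Qed.

Lemma valid_enc_lt k q d :
  q < nslots.+1 -> valid k q d -> enc base d (2 * m) < nstates.
Proof. by move=> qM v; apply: enc_lt => j; apply: valid_lt v. Qed.

Record at_cell s g k q : Prop := AtCell {
  at_g : regs s r_g = g;
  at_s : regs s r_s = g %% nstates;
  at_k : regs s r_k = k;
  at_q : regs s r_q = q;
  at_t : regs s r_t = q %/ m }.

Definition halved k d j := level k.+1 j - slack k d j %/ 2.
Definition picked i t (d : nat -> nat) j := d j + (j == i) * t + (j == m + i).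

Lemma eval_levelE s j ek : constants s -> budgets s -> j < 2 * m -> eval s ek <= K ->
  eval s (levelE m j ek) = level (eval s ek) j.
Proof.
move=> cs bs jm ekK; rewrite /levelE /= (eval_addr _ _ _ (const_off cs)) (const_pow cs) // /level.
congr (_ %/ _); rewrite /budgetE /budget; case: ltnP => /= jm'.
  by rewrite bs.
by rewrite (const_cap cs) //; lia.
Qed.

(** The new drop is at most half of the old one, rounded up. The old one is at most 2 * B + 1 for B
    = [nslots * p.+1], which gives the B + 1 allowed at slot 0. *)
Lemma valid_halved k q d : valid k q d -> q = nslots -> valid k.+1 0 (halved k d).
Proof.
move=> vd qE j jm; have [h1 h2] := vd _ jm; split; first exact: leq_subr.
rewrite /halved /slack /level expnSr divnMA.
by move: h1 h2; rewrite /level qE; lia.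
Qed.

Lemma slack_halved k d j : slack k.+1 (halved k d) j = slack k d j %/ 2.
Proof. by rewrite /halved /slack /level expnSr divnMA; lia. Qed.

Lemma completable_halved k q d : q = nslots ->
  completable m p c k q (slack k d) <->
  completable m p c k.+1 0 (slack k.+1 (halved k d)).
Proof.
move=> ->; apply: iff_trans (completable_halve p c m_gt0 k (slack k d)) _.
by split; apply: (completable_eq m_gt0) => j _; rewrite slack_halved.
Qed.

Lemma valid_skip k q d : valid k q d -> valid k q.+1 d.
Proof. by move=> vd j jm; have [h1 h2] := vd _ jm; split=> //; lia. Qed.

Lemma valid_picked k q d i : valid k q d -> i < m -> q < nslots ->
  q %/ m <= slack k d i -> 0 < slack k d (m + i) ->
  valid k q.+1 (picked i (q %/ m) d).
Proof.
move=> vd im qM'; have tp : q %/ m < p.+1 by rewrite ltn_divLR.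
rewrite /slack /picked; move: (q %/ m) tp => t tp ti tmi j jm.
have [] := vd _ jm; rewrite mulSn addnCA; move: (_ + q * p.+1) => b.
by case: eqP => [ji|_]; case: eqP => [jmi|_] /=; subst; split; lia.
Qed.

Lemma completable_picked k q d i :
  completable m p c k q.+1 (use m i (q %/ m) (slack k d)) <->
  completable m p c k q.+1 (slack k (picked i (q %/ m) d)).
Proof.
by split; apply: (completable_eq m_gt0) => j _; rewrite /use /slack /picked !subnDA.
Qed.

Section AtCell.
Variables (s : state) (k q : nat) (d : nat -> nat).
Hypotheses (cs : constants s) (bs : budgets s) (kK : k < K)
  (qM : q < nslots.+1) (vd : valid k q d) (ac : at_cell s (cell k q d) k q).

Let off_s : regs s r_off = off := const_off cs.

Lemma reg_s_enc : regs s r_s = enc base d (2 * m).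
Proof.
by rewrite (at_s ac) /cell modnMDl modn_small //; apply: valid_enc_lt vd.
Qed.

Lemma eval_digitE j : j < 2 * m -> eval s (digitE j) = d j.
Proof.
move=> jm; rewrite /digitE /= eval_powE /= reg_s_enc (const_A cs) enc_digit //.
by move=> i; apply: valid_lt vd.
Qed.

Lemma eval_presentE : (eval s (presentE m) != 0) = (q %% m < rho m c k (q %/ m)).
Proof.
have eC ek : eval s ek <= K ->
    eval s (cntE m ek (Reg r_t)) = cnt m c (eval s ek) (q %/ m).
  move=> ekK; rewrite /cntE /= !(eval_addr _ _ _ off_s) (const_pow cs) //.
  by rewrite (const_count cs) /= (at_t ac).
rewrite -[eval s _]/(nat_of_bool (regs s r_q %% m <
  eval s (cntE m (Reg r_k) (Reg r_t)) -
  2 * eval s (cntE m (Reg r_k [+] Const 1) (Reg r_t)))).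
by rewrite !eC /= ?(at_k ac) ?addn1 ?(ltnW kK) // (at_q ac) eqb0 negbK.
Qed.

Lemma eval_goto_halveE : q = nslots ->
  eval s (goto_halveE m) = cell k.+1 0 (halved k d).
Proof.
move=> qE; rewrite -[eval s _]/(regs s r_g - regs s r_s + regs s r_S +
  eval s (halveE m)) reg_s_enc (at_g ac) (const_S cs) eval_sumE.
rewrite /cell addnK -mulSnr; congr (_ * _ + _).
  by rewrite /row qE; lia.
apply: eq_bigr => j _; rewrite -[eval s _]/((
  eval s (levelE m j (Reg r_k [+] Const 1)) -
  (eval s (levelE m j (Reg r_k)) - eval s (digitE j)) %/ 2) *
  eval s (powE (Reg r_A) j)).
by rewrite !eval_levelE ?eval_digitE ?eval_powE //= (at_k ac) ?addn1 ?(const_A cs) //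
  ltnW.
Qed.

Lemma eval_goto_skipE : eval s goto_skipE = cell k q.+1 d.
Proof.
rewrite /goto_skipE /= (at_g ac) (const_S cs) /cell /row addnS mulSn; lia.
Qed.

Lemma eval_goto_itemE i : i < m ->
  eval s (goto_itemE m i) = cell k q.+1 (picked i (q %/ m) d).
Proof.
move=> im; rewrite /goto_itemE /= !eval_powE /= (at_g ac) (const_S cs) (at_t ac).
rewrite (const_A cs) /cell enc_add; [|lia|lia].
by rewrite /row addnS mulSn; lia.
Qed.

End AtCell.

(** Nothing is claimed about cells that encode no valid state. The bound on the row ends the table
    at slot 0 of level [K]. *)
Definition table_ok s g0 := forall k q d, q < nslots.+1 -> row k q <= nrows ->
  valid k q d -> g0 <= cell k q d ->
  (mem s (ad a_table (cell k q d)) <> 0) <-> completable m p c k q (slack k d).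

(** Transitions go to larger indices only, so filling the table downwards finds every successor
    already computed. *)
Lemma cell_mono k q d k' q' d' : q < nslots.+1 -> valid k q d ->
  row k' q' = (row k q).+1 -> cell k q d < cell k' q' d'.
Proof.
move=> qM v e; have := valid_enc_lt qM v.
by rewrite /cell e mulSn; lia.
Qed.

(** If the bounds admit the bundle, the successor state is valid and its cell can be trusted;
    otherwise a zero factor hides whatever was looked up. *)
Lemma eval_can_pickE s k q d i : constants s -> budgets s -> k < K ->
  q < nslots -> valid k q d -> at_cell s (cell k q d) k q ->
  table_ok s (cell k q d).+1 -> i < m ->
  eval s (can_pickE m i) <> 0 <->
  [/\ q %/ m <= slack k d i, 0 < slack k d (m + i)
    & completable m p c k q.+1 (slack k (picked i (q %/ m) d))].
Proof.
move=> cs bs kK qM v ac tab im; have qM1 := ltnW qM.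
have [i2 mi2] : i < 2 * m /\ m + i < 2 * m by lia.
have Ek : eval s (Reg r_k) = k := at_k ac.
rewrite -[eval s _]/(
  (regs s r_t + eval s (digitE i) < eval s (levelE m i (Reg r_k)) + 1) *
  (eval s (digitE (m + i)) < eval s (levelE m (m + i) (Reg r_k))) *
  mem s (regs s r_off + ((m + 4) * eval s (goto_itemE m i) + a_table))).
rewrite (eval_addr _ _ _ (const_off cs)).
rewrite (eval_digitE cs _ v ac) // (eval_digitE cs _ v ac) //.
rewrite (eval_levelE cs bs) ?Ek ?(ltnW kK) //.
rewrite (eval_levelE cs bs) ?Ek ?(ltnW kK) //.
rewrite (eval_goto_itemE (k := k) (q := q) (d := d)) // (at_t ac) addn1 ltnS.
have [h1 _] := v i i2.
have -> : (q %/ m + d i <= level k i) = (q %/ m <= slack k d i).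
  by rewrite /slack; lia.
have -> : (d (m + i) < level k (m + i)) = (0 < slack k d (m + i)).
  by rewrite /slack; lia.
case: (leqP (q %/ m) (slack k d i)) => h2; last by rewrite -[nat_of_bool false]/0 !mul0n; split=> // -[].
case: (ltnP 0 (slack k d (m + i))) => h3; last by rewrite -[nat_of_bool false]/0 muln0 mul0n; split=> // -[].
rewrite -[nat_of_bool true]/1 !mul1n tab //.
- by split=> [?|[]].
- have : row k q.+1 <= row k.+1 0 by rewrite /row; lia.
  by move/leq_trans; apply; rewrite /row addn0 leq_mul2r kK orbT.
- exact: (valid_picked v).
- by apply: cell_mono v _; rewrite // /row addnS.
Qed.

Lemma runs_step X (X2 : 1 < X) s goto pick fail Q : constants s ->
  (regs s r_q = nslots ->
     runs X (goto (goto_halveE m)) s (max_cost (goto (goto_halveE m))) Q) ->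
  (regs s r_q <> nslots -> eval s (presentE m) <> 0 ->
     forall i, i < m -> eval s (can_pickE m i) <> 0 ->
     runs X (pick i ;; goto (goto_itemE m i)) s
       (max_cost (pick i ;; goto (goto_itemE m i))) Q) ->
  (regs s r_q <> nslots -> eval s (presentE m) <> 0 ->
     (forall i, i < m -> eval s (can_pickE m i) = 0) ->
     runs X fail s (max_cost fail) Q) ->
  (regs s r_q <> nslots -> eval s (presentE m) = 0 ->
     runs X (goto goto_skipE) s (max_cost (goto goto_skipE)) Q) ->
  runs X (step m goto pick fail) s (max_cost (step m goto pick fail)) Q.
Proof.
move=> cs h1 h2 h3 h4; apply: runs_if_max => //=.
  rewrite (const_M cs) subn1 /=; case: eqP => // e _; exact: h1.
rewrite (const_M cs) subn1 /=; case: eqP => // e _.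
apply: runs_if_max => //= pr; last exact: h4.
apply: runs_first_of => // [i|].
  by rewrite mem_iota add0n => im; apply: h2.
by move=> z; apply: h3 => // i im; apply: z; rewrite mem_iota.
Qed.

End Cells.

(** * Filling one table cell *)

Section Deciding.
Variables (m n p K : nat) (P c num den cap U : nat -> nat).
Hypothesis m_gt0 : 0 < m.

Notation ad := (addr m (off m n)).
Notation M := (nslots m p).
Notation S := (nstates m p).
Notation N := (nrows m p K).
Notation constants := (constants m n p K P c num den cap).
Notation cell' := (cell m p).
Notation row := (row m p).

Notation budgets := (budgets m U).
Notation valid := (valid m p cap U).
Notation slack' := (slack m cap U).
Notation table_ok := (table_ok m n p K c cap U).

Lemma nstates_gt0 : 0 < S.
Proof. by rewrite expn_gt0 /base addn2. Qed.

Lemma frame_update arrays s x v : 20 <= x < 30 ->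
  frame m n arrays s (State (update (regs s) x v) (mem s)).
Proof.
by move=> xs; split=> // y ys; rewrite /= updateE; case: eqP => // e; lia.
Qed.

Lemma frame_sub (a1 a2 : pred nat) s s' :
  (forall r, a1 r -> a2 r) -> frame m n a1 s s' -> frame m n a2 s s'.
Proof. by move=> sub [fR fM]; split=> // a h; apply: fM => r i /sub; apply: h. Qed.

Lemma frame_put (arrays : pred nat) s r i v : arrays r ->
  frame m n arrays s (State (regs s) (update (mem s) (ad r i) v)).
Proof.
by move=> ar; split=> // a h; rewrite /= updateE; case: eqP => // /h; case.
Qed.

Lemma row_div k q : q < M.+1 -> row k q %/ M.+1 = k /\ row k q %% M.+1 = q.
Proof. by move=> qM; rewrite /row divnMDl // modnMDl divn_small // modn_small // addn0. Qed.

Lemma cell_div k q d : q < M.+1 -> valid k q d -> cell' k q d %/ S = row k q.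
Proof.
move=> qM v; rewrite /cell divnMDl ?nstates_gt0 // divn_small ?addn0 //.
exact: valid_enc_lt v.
Qed.

Lemma at_cell_div s k q d : q < M.+1 -> valid k q d ->
  at_cell m p s (cell' k q d) (cell' k q d %/ S %/ M.+1) (cell' k q d %/ S %% M.+1) ->
  at_cell m p s (cell' k q d) k q.
Proof. by move=> qM v; rewrite cell_div //; case: (row_div k qM) => -> ->. Qed.

Lemma row_le k q : q < M.+1 -> row k q <= N -> k < K \/ k = K /\ q = 0.
Proof.
move=> qM; rewrite /row /nrows; case: (ltngtP k K) => [|kK|->]; first by left.
  have : K.+1 * M.+1 <= k * M.+1 by rewrite leq_mul2r kK orbT.
  by rewrite mulSn; lia.
by right; split=> //; lia.
Qed.

Lemma cell_lt k q d : q < M.+1 -> row k q <= N -> valid k q d ->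
  cell' k q d < N.+1 * S.
Proof.
move=> qM rN v; have := valid_enc_lt m_gt0 qM v; rewrite /cell.
by have : row k q * S <= N * S; [rewrite leq_mul2r rN orbT | rewrite mulSn; lia].
Qed.

Variable X : nat.
Hypothesis X2 : 1 < X.

Lemma runs_decode s g : constants s -> regs s r_g = g ->
  runs X (decode m) s (max_cost (decode m)) (fun s' =>
    frame m n pred0 s s' /\
    at_cell m p s' g (g %/ S %/ M.+1) (g %/ S %% M.+1)).
Proof.
move=> cs eg; apply: runs_bounded => -[bR bM].
have gX : g <= X by rewrite -eg.
apply: runs_seq; apply: runs_assign => //=.
  by rewrite eg; apply: leq_trans (leq_mod _ _) gX.
apply: runs_seq; apply: runs_assign => //=; rewrite !updateE /=.
  by rewrite eg; apply: leq_trans (leq_div _ _) (leq_trans (leq_div _ _) gX).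
apply: runs_seq; apply: runs_assign => //=; rewrite !updateE /=.
  by rewrite eg; apply: leq_trans (leq_mod _ _) (leq_trans (leq_div _ _) gX).
apply: runs_assign => //=; rewrite !updateE /=.
  rewrite eg.
  apply: leq_trans (leq_div _ _) (leq_trans (leq_mod _ _) _).
  exact: leq_trans (leq_div _ _) gX.
split.
  split=> // x xs; rewrite /= !updateE.
  by do ![case: eqP => [ex|_]; first by rewrite ex in xs].
by split; rewrite /= !updateE //= eg ?(const_S cs) ?(const_M cs).
Qed.

Hypothesis cells_le : N.+1 * S <= X.
Hypothesis c_lt : forall t, t < p.+1 -> c t < 2 ^ K.

Lemma runs_fill_cell s g : constants s -> budgets s -> table_ok s g.+1 ->
  regs s r_g = g.+1 -> g < N.+1 * S ->
  runs X (fill_cell m) s (max_cost (fill_cell m)) (fun s' =>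
    [/\ frame m n (pred1 a_table) s s', regs s' r_g = g & table_ok s' g]).
Proof.
move=> cs bs tab eg gN.
apply: runs_seq; apply: runs_assign => //=.
  by rewrite eg subn1 /=; apply: ltnW; apply: leq_trans gN _.
rewrite eg subn1 /=; set s1 := State _ _.
have f1 : frame m n pred0 s s1 by apply: frame_update.
have cs1 : constants s1 by apply: frame_constants f1 cs.
apply: runs_seq; apply: runs_weaken (runs_decode (g := g) cs1 _) _ _ => //.
move=> s2 [f12 ac]; have f2 := frame_trans f1 f12.
have cs2 : constants s2 by apply: frame_constants f2 cs.
have bs2 : budgets s2 by move=> i im; rewrite f2.1 ?bs // leq_addr orbT.
have tab2 : table_ok s2 g.+1.
  by move=> k q d qM rN v gd; rewrite f2.2 //; apply: tab.
set k0 := g %/ S %/ M.+1 in ac; set q0 := g %/ S %% M.+1 in ac.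
have k0K : k0 <= K.
  rewrite -ltnS /k0 ltn_divLR // ltn_divLR ?nstates_gt0 //.
  by apply: leq_trans gN _; rewrite leq_mul2r /nrows mulSn ltnS leq_addl orbT.
have [k0E q0E] : k0 = g %/ S %/ M.+1 /\ q0 = g %/ S %% M.+1 by [].
(* The number [g] need not be the code of a valid state, so the claim about [r_v] is conditional on
   being one; the program treats all cells alike. *)
clearbody k0 q0; pose post s3 := [/\ frame m n pred0 s s3, regs s3 r_g = g &
  forall d, q0 < M.+1 -> row k0 q0 <= N -> valid k0 q0 d -> g = cell' k0 q0 d ->
    regs s3 r_v <> 0 <-> completable m p c k0 q0 (slack' k0 d)].
have set_v v : (forall d, q0 < M.+1 -> row k0 q0 <= N -> valid k0 q0 d ->
      g = cell' k0 q0 d -> v <> 0 <-> completable m p c k0 q0 (slack' k0 d)) ->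
    post (State (update (regs s2) r_v v) (mem s2)).
  move=> h; split=> //; first by apply: frame_trans f2 _; apply: frame_update.
  by rewrite /= updateE /= (at_g ac).
apply: runs_bounded => -[_ bM2].
have run_cell : runs X (eval_cell m) s2 (max_cost (eval_cell m)) post.
  apply: runs_if_max => //; rewrite [eval _ _]/= (at_k ac) (const_K cs2) => /eqP.
    rewrite eqb0 negbK => /eqP kK; apply: runs_assign => //=; first by lia.
    (* Only slot 0 of level [K] lies within the table; all counts vanish there, so the answer 1 is
       right. *)
    apply: set_v => d qM rN v e; split=> // _.
    have [|[_ ->]] := row_le qM rN; first by lia.
    by apply: completable_last => // t tp; rewrite kK c_lt.
  rewrite eqb0 => kK; have k0K' : k0 < K by lia.
  have read_cell e : eval s2 e = eval s2 e ->
      (forall d, q0 < M.+1 -> row k0 q0 <= N -> valid k0 q0 d ->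
        g = cell' k0 q0 d ->
        mem s2 (ad a_table (eval s2 e)) <> 0 <->
        completable m p c k0 q0 (slack' k0 d)) ->
      runs X (r_v ::= get m a_table e) s2 (max_cost (r_v ::= get m a_table e)) post.
    move=> _ h; apply: runs_assign => //; first exact: bM2.
    by apply: set_v; rewrite /= (eval_addr _ _ _ (const_off cs2)).
  apply: (runs_step X2 cs2) => //.
  - rewrite (at_q ac) => q0M; apply: read_cell => // d qM rN v gd.
    rewrite gd in ac; rewrite (eval_goto_halveE m_gt0 cs2 bs2 k0K' qM v ac) //.
    apply: iff_trans (iff_sym (completable_halved c cap U m_gt0 k0 d q0M)).
    apply: tab2 => //.
    + by rewrite /row /nrows addn0 leq_mul2r k0K' orbT.
    + exact: (valid_halved m_gt0 v).
    + by rewrite gd; apply: cell_mono v _; rewrite // /row q0M; lia.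
  - rewrite (at_q ac) => q0M pr i im pk; apply: runs_seq.
    apply: runs_skip => //; apply: read_cell => // d qM rN v gd.
    rewrite gd in ac tab2; have q0M' : q0 < M by lia.
    have [h1 h2 h3] := (eval_can_pickE m_gt0 cs2 bs2 k0K' q0M' v ac tab2 im).1 pk.
    rewrite (eval_goto_itemE m_gt0 cs2 k0K' qM ac) //.
    have pr' : q0 %% m < rho m c k0 (q0 %/ m).
      by rewrite -(eval_presentE cs2 k0K' ac); apply/eqP.
    rewrite tab2 //.
    + split=> // _; apply/(completable_item m_gt0) => //.
      by exists i; split=> //; apply/(completable_picked _ _ _ _ m_gt0).
    + by apply: leq_trans (_ : row k0.+1 0 <= N); rewrite /row /nrows ?addn0 ?leq_mul2r ?k0K' ?orbT //; lia.
    + exact: (valid_picked m_gt0 v).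
    + by apply: cell_mono v _; rewrite // /row addnS.
  - rewrite (at_q ac) => q0M pr pk; apply: runs_assign => //.
    apply: set_v => d qM rN v gd; have q0M' : q0 < M by lia.
    rewrite gd in ac tab2; have pr' : q0 %% m < rho m c k0 (q0 %/ m).
      by rewrite -(eval_presentE cs2 k0K' ac); apply/eqP.
    split=> // /(completable_item m_gt0 _ q0M' pr').
    move=> [i [im h1 h2 /(completable_picked _ _ _ _ m_gt0) h3]].
    by have /(_ (And3 h1 h2 h3)) := (eval_can_pickE m_gt0 cs2 bs2 k0K' q0M' v ac tab2 im).2; rewrite pk.
  - rewrite (at_q ac) => q0M pr; apply: read_cell => // d qM rN v gd.
    rewrite gd in ac; rewrite (eval_goto_skipE m_gt0 cs2 k0K' qM ac).
    have q0M' : q0 < M by lia.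
    have pr' : ~~ (q0 %% m < rho m c k0 (q0 %/ m)).
      by rewrite -(eval_presentE cs2 k0K' ac) pr.
    apply: iff_trans (iff_sym (completable_skip p m_gt0 _ pr')).
    apply: tab2 => //.
    + by apply: leq_trans (_ : row k0.+1 0 <= N); rewrite /row /nrows ?addn0 ?leq_mul2r ?k0K' ?orbT //; lia.
    + exact: (valid_skip m_gt0 v).
    + by rewrite gd; apply: cell_mono v _; rewrite // /row addnS.
apply: runs_seq; apply: runs_weaken run_cell _ _ => // s3 [f3 eg3 hv].
have cs3 : constants s3 by apply: frame_constants f3 cs.
apply: runs_bounded => -[bR3 _].
apply: runs_write => //=.
rewrite (eval_addr _ _ _ (const_off cs3)) eg3; split=> //.
  apply: frame_trans (frame_sub _ f3) _ => //; exact: frame_put.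
move=> k q d qM rN v; rewrite leq_eqVlt /= updateE addr_inj /=; try lia.
case/predU1P => [gd|gd].
  rewrite -gd eqxx /=; have [ek eq] := row_div k qM.
  move: hv; rewrite q0E k0E gd cell_div // ek eq; apply=> //.
by rewrite gtn_eqF // f3.2 //; apply: tab.
Qed.

End Deciding.

(** * Deciding a makespan, and extracting a distribution from the table *)

Definition mult_array m r := 4 <= r < m + 4.

Lemma mult_array_ok m r : mult_array m r -> 2 < r < m + 4.
Proof. by rewrite /mult_array; lia. Qed.

Section Walking.
Variables (m n p K : nat) (P c num den cap : nat -> nat).
Hypothesis m_gt0 : 0 < m.

Notation ad := (addr m (off m n)).
Notation M := (nslots m p).
Notation S := (nstates m p).
Notation N := (nrows m p K).
Notation constants := (constants m n p K P c num den cap).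
Notation cell' := (cell m p).
Notation row := (row m p).

Variable X : nat.
Hypothesis X2 : 1 < X.
Hypothesis cells_le : N.+1 * S <= X.
Hypothesis c_lt : forall t, t < p.+1 -> c t < 2 ^ K.

(* The largest integral load of machine i that respects the makespan a / b. *)
Definition max_load a b i := a * num i %/ (b * den i).

Lemma runs_set_budgets s l a b : constants s ->
  regs s r_num = a -> regs s r_den = b ->
  (forall i, i \in l -> i < m) -> (forall i, i < m -> max_load a b i <= X) ->
  runs X (set_budgets l) s (max_cost (set_budgets l)) (fun s' =>
    [/\ forall i, i \in l -> regs s' (r_U i) = max_load a b i,
        forall x, (forall i, i \in l -> x <> r_U i) -> regs s' x = regs s x
      & mem s' = mem s]).
Proof.
move=> cs ea eb lm UX; elim: l s cs ea eb lm => [|i l IH] s cs ea eb lm.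
  by apply: runs_skip.
have im : i < m by apply: lm; rewrite mem_head.
have ev : eval s ((Reg r_num [*] Read (Const (3 * i + 1))) [/]
   (Reg r_den [*] Read (Const (3 * i + 2)))) = max_load a b i.
  by rewrite [LHS]/= (const_num cs) // (const_den cs) // ea eb.
apply: runs_seq; apply: runs_assign => //; first by rewrite ev UX.
rewrite ev; set s1 := State _ _.
have low x : x < 30 -> regs s1 x = regs s x.
  by move=> x30; rewrite /s1 /= updateE; case: eqP => // e; lia.
have cs1 : constants s1.
  by case: cs => *; split; rewrite ?low.
apply: runs_weaken (IH s1 cs1 _ _ _) _ _ => //.
  by move=> i' il; apply: lm; rewrite inE il orbT.
move=> s2 [h1 h2 h3]; split=> // [i'|x xl].
  rewrite inE; have [il _|il] := boolP (i' \in l); first exact: h1.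
  rewrite orbF => /eqP ->; have [il'|il'] := boolP (i \in l); first exact: h1.
  rewrite h2 ?/s1 /= ?updateE ?eqxx // => i'' il'' e.
  by have ee : i = i'' by [lia]; rewrite ee il'' in il'.
rewrite h2 => [|i' il]; last by apply: xl; rewrite inE il orbT.
by rewrite /s1 /= updateE; case: eqP => // e; have := xl i (mem_head _ _).
Qed.

Definition decide_time :=
  max_cost (set_budgets (iota 0 m)) +
  (max_cost (r_g ::= (Reg r_N [+] Const 1) [*] Reg r_S) +
   (N.+1 * S).+1 * (max_cost (fill_cell m) + 2)).

Lemma runs_decide s a b : constants s ->
  regs s r_num = a -> regs s r_den = b ->
  (forall i, i < m -> max_load a b i <= X) ->
  runs X (decide m) s decide_time (fun s' =>
    [/\ constants s', budgets m (max_load a b) s',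
        forall x, x < 20 -> regs s' x = regs s x,
        forall a, (forall i, a <> ad a_table i) -> mem s' a = mem s a
      & table_ok m n p K c cap (max_load a b) s' 0]).
Proof.
move=> cs ea eb UX; apply: runs_seq.
apply: runs_weaken (runs_set_budgets (a := a) (b := b) cs _ _ _ _) _ _ => //.
  by move=> i; rewrite mem_iota.
move=> s1 [h1 h2 h3]; have low x : x < 30 -> regs s1 x = regs s x.
  by move=> x30; apply: h2 => i _; lia.
have cs1 : constants s1.
  by case: cs => *; split; rewrite ?h3 ?low.
have bs1 : budgets m (max_load a b) s1.
  by move=> i im; apply: h1; rewrite mem_iota.
have gE : eval s1 ((Reg r_N [+] Const 1) [*] Reg r_S) = N.+1 * S.
  by rewrite [LHS]/= (const_N cs1) (const_S cs1) addn1.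
apply: runs_seq; apply: runs_assign => //; first by rewrite gE.
rewrite gE; set s2 := State _ _.
have f12 : frame m n pred0 s1 s2 by apply: frame_update.
pose Inv g s' := [/\ frame m n (pred1 a_table) s1 s', regs s' r_g = g, g <= N.+1 * S
  & table_ok m n p K c cap (max_load a b) s' g].
have arr r : pred1 a_table r -> 2 < r < m + 4 by move=> /= /eqP ->; lia.
apply: (@runs_while _ X2 _ _ Inv).
- move=> g s' [f eg gN tab] /=; rewrite eg; case: g => // g in eg gN tab * => _.
  exists g => //.
  have cs' : constants s' by apply: frame_constants f cs1.
  apply: runs_weaken (runs_fill_cell (g := g) m_gt0 X2 cells_le c_lt cs' _ tab eg gN) _ _ => //.
    by move=> i im; rewrite f.1 ?bs1 // leq_addr orbT.
  by move=> s3 [f3 eg3 tab3]; split=> //; [apply: frame_trans f f3 | apply: ltnW].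
- move=> g s' [f eg gN tab] /=; rewrite eg => g0; rewrite g0 in tab; split=> //.
  + exact: frame_constants f cs1.
  + by move=> i im; rewrite f.1 ?bs1 // leq_addr orbT.
  + by move=> x x20; rewrite f.1 ?x20 // low //; lia.
  + by move=> y hy; rewrite f.2 ?h3 // => r i /eqP ->; apply: hy.
split=> //; first by apply: frame_sub f12.
(* No cell of the table has an index this large, so the initial invariant is vacuous. *)
move=> k q d qM rN v gc; have := cell_lt m_gt0 qM rN v.
by rewrite ltnNge gc.
Qed.

Section Walk.
Variables (U : nat -> nat) (s0 : state).
Notation valid := (valid m p cap U).
Notation slack' := (slack m cap U).

Notation mult_array' := (mult_array m).
Definition mult s i t := mem s (ad (a_mult i) t).

Hypotheses (cs0 : constants s0) (bs0 : budgets m U s0)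
  (tab0 : table_ok m n p K c cap U s0 0)
  (mult0 : forall i t, i < m -> mult s0 i t = 0)
  (feasible0 : splittable m p c (budget m cap U))
  (c_le : forall t, t < p.+1 -> c t <= X).

(** Conservation along the walk, in units of single jobs: a bundle or a unit of slack at level [k]
    counts 2 ^ k. *)
Definition partial_mult s k q d :=
  (forall t, t < p.+1 ->
     \sum_(i < m) mult s i t + 2 ^ k * (rest m c k q t + 2 * cnt m c k.+1 t) = c t) /\
  (forall i, i < m ->
     \sum_(t < p.+1) t * mult s i t + 2 ^ k * slack' k d i <= U i /\
     \sum_(t < p.+1) mult s i t + 2 ^ k * slack' k d (m + i) <= cap i).

Lemma eq_partial_mult s s' k q d : (forall i t, mult s' i t = mult s i t) ->
  partial_mult s k q d -> partial_mult s' k q d.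
Proof.
move=> e [h1 h2]; split=> [t tp|i im].
  by rewrite -(h1 t tp); congr (_ + _); apply: eq_bigr => i _; rewrite e.
have [h3 h4] := h2 i im; split.
  by apply: leq_trans h3; rewrite leq_add2r; apply: leq_sum => t _; rewrite e.
by apply: leq_trans h4; rewrite leq_add2r; apply: leq_sum => t _; rewrite e.
Qed.

Record on_walk s k q d : Prop := OnWalk {
  walk_frame : frame m n mult_array' s0 s;
  walk_g : regs s r_g = cell' k q d;
  walk_q : q < M.+1;
  walk_row : row k q <= N;
  walk_valid : valid k q d;
  walk_completable : completable m p c k q (slack' k d);
  walk_mult : partial_mult s k q d }.

Definition walk_time :=
  max_cost (r_g ::= Const 0) + N.+1 * (max_cost (walk_cell m) + 6).

Lemma table_walk s : frame m n mult_array' s0 s ->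
  table_ok m n p K c cap U s 0.
Proof.
move=> f k q d qM rN v le.
rewrite (frame_addr (arrays := mult_array') _ f); [exact: tab0| |lia|by []].
exact: mult_array_ok.
Qed.

Lemma runs_goto e s1 g (Q : state -> Prop) : eval s1 e = g -> g <= X ->
  Q (State (update (regs s1) r_g g) (mem s1)) ->
  runs X (r_g ::= e) s1 (max_cost (r_g ::= e)) Q.
Proof. by move=> <- gX q; apply: runs_assign. Qed.

Lemma eval_goto_itemE_mem s f i :
  eval (State (regs s) f) (goto_itemE m i) = eval s (goto_itemE m i).
Proof. by rewrite /goto_itemE /= !eval_powE. Qed.

Lemma on_walk_goto s s1 k q d :
  frame m n mult_array' s0 s -> frame m n mult_array' s s1 ->
  q < M.+1 -> row k q <= N -> valid k q d ->
  completable m p c k q (slack' k d) -> partial_mult s1 k q d ->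
  on_walk (State (update (regs s1) r_g (cell' k q d)) (mem s1)) k q d.
Proof.
move=> f f1 qM rN v cp pm; split=> //.
  by apply: frame_trans f (frame_trans f1 _); apply: frame_update.
Qed.

(** The walk visits completable states only. There the table must offer a completable successor, so
    it never gets stuck and never backtracks. *)
Lemma runs_walk_cell s k q d : on_walk s k q d -> k < K ->
  runs X (walk_cell m) s (max_cost (walk_cell m)) (fun s' =>
    exists k' q' d', on_walk s' k' q' d' /\ row k' q' = (row k q).+1).
Proof.
case=> f eg qM rN v cp [pm1 pm2] kK.
have cs : constants s.
  by apply: frame_constants f cs0 => //; exact: mult_array_ok.
apply: runs_seq; apply: runs_weaken (runs_decode X2 cs eg) _ _ => //.
move=> s2 [f2 /(at_cell_div m_gt0 qM v) ac].
have cs2 : constants s2 by apply: frame_constants f2 cs.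
have fm2 : frame m n mult_array' s s2 by apply: frame_sub f2.
have f02 := frame_trans f fm2.
have bs2 : budgets m U s2 by move=> i im; rewrite f02.1 ?bs0 // leq_addr orbT.
have mult2 i t : mult s2 i t = mult s i t by rewrite /mult f2.2.
have tab2 : table_ok m n p K c cap U s2 (cell' k q d).+1.
  by move=> k' q' d' qM' rN' v' _; apply: (table_walk f02).
have rK : row k.+1 0 <= N by rewrite /row /nrows addn0 leq_mul2r kK orbT.
have rS : row k q.+1 <= row k.+1 0 by rewrite /row; lia.
have leX k' q' d' : q' < M.+1 -> row k' q' <= N -> valid k' q' d' ->
    cell' k' q' d' <= X.
  move=> h1 h2 h3; apply: leq_trans cells_le.
  exact: ltnW (cell_lt m_gt0 h1 h2 h3).
have q_lt : q <> M -> q < M by lia.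
apply: (runs_step X2 cs2) => //; rewrite (at_q ac) => qE.
- have vh := valid_halved m_gt0 v qE.
  apply: (@runs_goto _ _ (cell' k.+1 0 (halved m cap U k d))).
  + exact: (eval_goto_halveE m_gt0 cs2 bs2 kK qM v ac).
  + exact: leX.
  exists k.+1, 0, (halved m cap U k d); split; last by rewrite /row qE mulSn; lia.
  apply: (on_walk_goto f fm2) => //.
    exact/(completable_halved c cap U m_gt0 k d qE).
  apply: (eq_partial_mult mult2); split=> [t tp|i im].
    have := pm1 t tp; rewrite qE (rest_end _ m_gt0) // add0n.
    by rewrite (rest0 _ m_gt0) (cnt_rho _ m_gt0) expnSr mulnA.
  have [h1 h2] := pm2 i im; rewrite !(slack_halved _ _ m_gt0) expnSr.
  move: h1 h2; gen_sums; move: (slack' k d i) (slack' k d (m + i)) (2 ^ k) => x y z.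
  by nia.
- move=> pr i im pk; have qM' := q_lt qE.
  have pr' : q %% m < rho m c k (q %/ m).
    by rewrite -(eval_presentE cs2 kK ac); apply/eqP.
  have [h1 h2 h3] := (eval_can_pickE m_gt0 cs2 bs2 kK qM' v ac tab2 im).1 pk.
  have tp : q %/ m < p.+1 by rewrite ltn_divLR.
  have vp := valid_picked m_gt0 v im qM' h1 h2.
  set t0 := q %/ m in tp vp h1 h3 pr' *.
  have evE : eval s2 (get m (a_mult i) (Reg r_t) [+] get m a_pow (Reg r_k)) =
      mult s i t0 + 2 ^ k.
    rewrite [LHS]/= !(eval_addr _ _ _ (const_off cs2)) (at_t ac) (at_k ac).
    by rewrite (const_pow cs2) ?(ltnW kK) // -/(mult s2 i t0) mult2.
  have restE t : rest m c k q t = (t == t0) + rest m c k q.+1 t.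
    by rewrite (restS _ m_gt0); case: eqP => [->|]; rewrite ?pr'.
  apply: runs_seq; apply: runs_write => //.
    (* As slot [q] is occupied, a bundle of 2 ^ k jobs of this size is still outstanding, so the
       increased multiplicity does not exceed [c t0]. *)
    rewrite evE; apply: leq_trans (c_le tp).
    rewrite -(pm1 _ tp) (bigD1 (Ordinal im)) //= restE eqxx.
    by gen_sums; move: (2 ^ k) => z; nia.
  rewrite evE; set s3 := State _ _.
  have aE : eval s2 (addrE m (a_mult i) (Reg r_t)) = ad (a_mult i) t0.
    by rewrite [LHS]/= (eval_addr _ _ _ (const_off cs2)) (at_t ac).
  have f3 : frame m n mult_array' s s3.
    apply: frame_trans fm2 _; rewrite /s3 aE; apply: frame_put.
    by rewrite /mult_array; lia.
  have mult3 i' t : i' < m ->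
      mult s3 i' t = mult s i' t + (i' == i) * ((t == t0) * 2 ^ k).
    move=> im'; rewrite /mult /s3 aE /= updateE addr_inj; [|lia|lia].
    rewrite eqn_add2l; case: (i' =P i) => [->|_]; last first.
      by rewrite /= addn0 -!/(mult _ _ _) mult2.
    case: (t =P t0) => [->|_] /=; first by rewrite !mul1n.
    by rewrite mul0n muln0 addn0 -!/(mult _ _ _) mult2.
  apply: (@runs_goto _ _ (cell' k q.+1 (picked m i t0 d))).
  + rewrite /s3 eval_goto_itemE_mem.
    exact: (eval_goto_itemE m_gt0 cs2 kK qM ac).
  + by apply: leX => //; apply: leq_trans rS rK.
  exists k, q.+1, (picked m i t0 d); split; last by rewrite /row addnS.
  apply: (on_walk_goto f f3) => //; first exact: leq_trans rS rK.
  split=> [t tp'|i' im'].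
    rewrite -(pm1 _ tp') restE.
    under eq_bigr => i' _ do rewrite mult3 //.
    rewrite big_split /= sum_delta //; gen_sums.
    by move: (t == t0 : nat) (2 ^ k) => e z; nia.
  have [g1 g2] := pm2 i' im'.
  under eq_bigr => t _ do rewrite mult3 // mulnDr.
  under [X in _ /\ X + _ <= _]eq_bigr => t _ do rewrite mult3 //.
  rewrite !big_split /=.
  have -> : \sum_(t < p.+1) t * ((i' == i) * ((t == t0 :> nat) * 2 ^ k)) =
      (i' == i) * (t0 * 2 ^ k).
    rewrite -[RHS](sum_delta _ tp); apply: eq_bigr => t _.
    by case: (t =P t0 :> nat) => [->|_] /=; nia.
  have -> : \sum_(t < p.+1) (i' == i) * ((t == t0 :> nat) * 2 ^ k) =
      (i' == i) * 2 ^ k.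
    rewrite -[RHS](sum_delta _ tp); apply: eq_bigr => t _.
    by case: (t =P t0 :> nat) => [_|_] /=; nia.
  move: g1 g2 h1 h2; rewrite /slack /picked !eqn_add2l.
  have -> : (m + i' == i) = false by lia.
  have -> : (i' == m + i) = false by lia.
  case: eqP => [->|_]; rewrite /= ?mul0n ?mul1n ?addn0 ?add0n; last by [].
  (* On machine [i], load 2 ^ k * t0 and 2 ^ k jobs pass from the slack to the multiplicities; [h1]
     and [h2] make the subtractions exact. *)
  rewrite !subnDA; gen_sums; move: (_ - d i) (_ - d (m + i)) (2 ^ k) => x y z.
  move=> g1 g2 h1 h2; have := mulnBr z x t0; have := mulnBr z y 1.
  by have : z * t0 <= z * x; [rewrite leq_mul2l h1 orbT | split; nia].
(* The failing branch contradicts completability. *)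
- move=> pr pk; have qM' := q_lt qE.
  have pr' : q %% m < rho m c k (q %/ m).
    by rewrite -(eval_presentE cs2 kK ac); apply/eqP.
  have [i [im h1 h2 /(completable_picked _ _ _ _ m_gt0) h3]] :=
    (completable_item m_gt0 _ qM' pr').1 cp.
  have /(_ (And3 h1 h2 h3)) := (eval_can_pickE m_gt0 cs2 bs2 kK qM' v ac tab2 im).2.
  by rewrite pk.
- move=> pr; have qM' := q_lt qE; have vs := valid_skip m_gt0 v.
  have pr' : ~~ (q %% m < rho m c k (q %/ m)).
    by rewrite -(eval_presentE cs2 kK ac) pr.
  apply: (@runs_goto _ _ (cell' k q.+1 d)).
  + exact: (eval_goto_skipE m_gt0 cs2 kK qM ac).
  + by apply: leX => //; apply: leq_trans rS rK.
  exists k, q.+1, d; split; last by rewrite /row addnS.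
  apply: (on_walk_goto f fm2) => //; first exact: leq_trans rS rK.
    exact/(completable_skip p m_gt0 _ pr').
  apply: (eq_partial_mult mult2); split=> // t tp; rewrite -(pm1 t tp).
  by rewrite [in RHS](restS _ m_gt0); case: eqP => [->|_] //; rewrite (negbTE pr').
Qed.

Lemma runs_walk : runs X (walk m) s0 walk_time (fun s =>
  [/\ frame m n mult_array' s0 s,
      forall t, t < p.+1 -> \sum_(i < m) mult s i t = c t
    & forall i, i < m -> \sum_(t < p.+1) t * mult s i t <= U i /\
                         \sum_(t < p.+1) mult s i t <= cap i]).
Proof.
apply: runs_seq; apply: runs_goto => //; set s1 := State _ _.
have f1 : frame m n mult_array' s0 s1 by apply: frame_update.
pose Inv r s := exists k q d, on_walk s k q d /\ r = N - row k q.
have cost6 : 6 = (cost (Reg r_g [<] Reg r_N [*] Reg r_S)).+1 by [].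
rewrite cost6; apply: (@runs_while _ X2 _ _ Inv).
- move=> r s [k [q [d [w ->]]]].
  have cs : constants s.
    by apply: frame_constants (walk_frame w) cs0 => //; exact: mult_array_ok.
  rewrite /= (walk_g w) (const_N cs) (const_S cs) => /eqP; rewrite eqb0 negbK => lt.
  have rN : row k q < N.
    by rewrite -(cell_div m_gt0 (walk_q w) (walk_valid w)) ltn_divLR ?nstates_gt0.
  have [kK|[kK q0]] := row_le m_gt0 (walk_q w) (walk_row w); last first.
    by move: rN; rewrite kK q0 /row /nrows addn0 ltnn.
  exists (N - (row k q).+1); first by lia.
  apply: runs_weaken (runs_walk_cell w kK) _ _ => // s' [k' [q' [d' [w' e]]]].
  by exists k', q', d'; rewrite e.
- move=> r s [k [q [d [w _]]]].
  have cs : constants s.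
    by apply: frame_constants (walk_frame w) cs0 => //; exact: mult_array_ok.
  rewrite /= (walk_g w) (const_N cs) (const_S cs) => /eqP; rewrite eqb0 -leqNgt => le.
  have rN : N <= row k q.
    by rewrite -(cell_div m_gt0 (walk_q w) (walk_valid w)) leq_divRL ?nstates_gt0.
  have [kK|[kK q0]] := row_le m_gt0 (walk_q w) (walk_row w).
    have qM := walk_q w; have : k.+1 * M.+1 <= K * M.+1 by rewrite leq_mul2r kK orbT.
    by move: rN; rewrite /row /nrows mulSn; lia.
  (* At level [K] nothing is outstanding, so conservation says that the multiplicities account for
     all jobs. *)
  have [pm1 pm2] := walk_mult w; split; first exact: walk_frame w.
    move=> t tp; have := pm1 t tp; rewrite kK q0 (rest0 _ m_gt0) (cnt_rho _ m_gt0) (cnt_eq0 m_gt0) ?c_lt //.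
    by rewrite muln0 addn0.
  move=> i im; have [h1 h2] := pm2 i im.
  by split; [apply: leq_trans h1 | apply: leq_trans h2]; rewrite leq_addr.
exists 0, 0, (fun=> 0); split; last by rewrite /row subn0.
split=> //.
- by rewrite /cell /row /s1 /= updateE /= /enc big1.
- apply/completable0 => //; case: feasible0 => z z1 z2; exists z => [t tp|].
    by rewrite z1 // (cnt0 _ m_gt0).
  by apply: (within_le m_gt0) z2 => // j jm; rewrite /slack /level divn1 subn0.
split=> [t tp|i im].
  by rewrite (rest0 _ m_gt0) (cnt_rho _ m_gt0) (cnt0 _ m_gt0) mul1n big1 // => i _; apply: mult0.
have im2 : m + i < m = false by lia.
have mult1 t : mult s1 i t = 0 by apply: mult0.
rewrite !big1 => [|t _|t _]; try by rewrite mult1 ?muln0.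
by rewrite /slack /level /budget im im2 expn0 !divn1 !subn0 !mul1n addKn.
Qed.

End Walk.
End Walking.

(** * Input, binary search and output *)

Section Assignments.
Variables (m n p : nat) (P : nat -> nat).

Definition count_size t := \sum_(j < n) (P j == t).
Definition count_class (sg : nat -> nat) (i t : nat) :=
  \sum_(j < n) (sg j == i) * (P j == t).
Definition work (sg : nat -> nat) (i : nat) := \sum_(j < n) (sg j == i) * P j.
Definition number (sg : nat -> nat) (i : nat) := \sum_(j < n) (sg j == i).

Hypothesis P_le : forall j, j < n -> P j <= p.

Lemma work_class sg i : work sg i = \sum_(t < p.+1) t * count_class sg i t.
Proof.
rewrite /count_class; under eq_bigr do rewrite big_distrr /=.
rewrite exchange_big; apply: eq_bigr => j _ /=.
rewrite -[LHS](sum_delta _ (P_le (ltn_ord j) : P j < p.+1)).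
apply: eq_bigr => t _; rewrite [P j == t]eq_sym.
by case: (t =P P j :> nat) => [->|_] /=; lia.
Qed.

Lemma number_class sg i : number sg i = \sum_(t < p.+1) count_class sg i t.
Proof.
rewrite exchange_big; apply: eq_bigr => j _ /=.
rewrite -[LHS](sum_delta _ (P_le (ltn_ord j) : P j < p.+1)).
by apply: eq_bigr => t _; rewrite [P j == t]eq_sym mulnC.
Qed.

Lemma count_size_class sg t : (forall j, j < n -> sg j < m) ->
  \sum_(i < m) count_class sg i t = count_size t.
Proof.
move=> sgm; rewrite exchange_big; apply: eq_bigr => j _ /=.
rewrite -[RHS](sum_delta _ (sgm _ (ltn_ord j))).
by apply: eq_bigr => i _; rewrite [sg j == i]eq_sym.
Qed.

Lemma count_size_le t : count_size t <= n.
Proof.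
rewrite -[leqRHS]card_ord -sum1_card; apply: leq_sum => j _.
exact: leq_b1.
Qed.

Lemma count_size_lt j : j < n -> \sum_(j' < j) (P j' == P j) < count_size (P j).
Proof.
move=> jn; rewrite /count_size -(subnKC jn) big_split_ord /= big_ord_recr /=.
by rewrite eqxx addn1 addSn ltnS leq_addr.
Qed.

End Assignments.

Section Input.
Variables (m n : nat) (P num den cap : nat -> nat) (mem0 : nat -> nat).
Hypotheses (m_gt0 : 0 < m) (n_gt0 : 0 < n).

Notation ad := (addr m (off m n)).

Record input_memory : Prop := InputMemory {
  input_n : mem0 0 = n;
  input_num : forall i, i < m -> mem0 (3 * i + 1) = num i;
  input_den : forall i, i < m -> mem0 (3 * i + 2) = den i;
  input_cap : forall i, i < m -> mem0 (3 * i + 3) = cap i;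
  input_proc : forall j, j < n -> mem0 (3 * m + 1 + j) = P j;
  input_end : forall a, off m n <= a -> mem0 a = 0 }.

Hypothesis inp : input_memory.

Definition max_proc j := \max_(j' < j) P j'.

Record jobs_read j s : Prop := JobsRead {
  jr_n : regs s r_n = n;
  jr_off : regs s r_off = off m n;
  jr_p : regs s r_p = max_proc j;
  jr_j : regs s r_j = j;
  jr_K : regs s r_K = 0;
  jr_bden : regs s r_bden = 0;
  jr_input : forall a, a < off m n -> mem s a = mem0 a;
  jr_proc : forall j', j' < j -> mem s (ad a_proc j') = P j';
  jr_count : forall t, mem s (ad a_count t) = count_size j P t;
  jr_rest : forall r i, 1 < r < m + 4 -> mem s (ad r i) = 0 }.

Variable X : nat.
Hypotheses (X2 : 1 < X) (n_le : 2 * n <= X) (off_le : off m n <= X).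

Lemma runs_read_job j s : jobs_read j s -> j < n ->
  runs X (read_job m) s (max_cost (read_job m)) (jobs_read j.+1).
Proof.
move=> jr jn; apply: runs_bounded => -[bR bM].
have mj : mem s (3 * m + 1 + j) = P j.
  by rewrite (jr_input jr) ?(input_proc inp) // /off; lia.
have PX : P j <= X by rewrite -mj.
apply: runs_seq_max; apply: runs_assign; first by [].
  by rewrite [eval _ _]/= (jr_j jr) mj.
rewrite [eval _ _]/= (jr_j jr) mj.
apply: runs_seq_max; apply: (runs_put (off := off m n)) => //; first exact: jr_off jr.
rewrite /= !updateE /= (jr_j jr).
apply: runs_seq_max; apply: (runs_put (off := off m n)) => //; first exact: jr_off jr.
  rewrite [eval _ _]/= !updateE /= (eval_addr _ _ _ (jr_off jr)).
  rewrite addr_inj /= ?(jr_count jr); try lia.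
  have := count_size_le j P (P j); lia.
have -> : eval (State (update (regs s) r_t (P j)) (update (mem s) (ad 0 j) (P j)))
    (get m a_count (Reg r_t) [+] Const 1) = (count_size j P (P j)).+1.
  rewrite [LHS]/= !updateE /= (eval_addr _ _ _ (jr_off jr)).
  rewrite addr_inj /= ?(jr_count jr); lia.
rewrite [eval _ (Reg r_t)]/= updateE /=; set M := update (update (mem s) _ _) _ _.
have Mlow a : a < off m n -> M a = mem0 a.
  move=> lt; rewrite /M !updateE -(jr_input jr) //.
  by do 2 (case: eqP => [ea|_]; first by rewrite ea ltnNge addr_ge in lt).
have M0 j' : j' < j.+1 -> M (ad a_proc j') = P j'.
  move=> lt; rewrite /M !updateE !addr_inj /=; try lia.
  by case: eqP => [->//|e]; rewrite (jr_proc jr) //; lia.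
have M1 t : M (ad a_count t) = count_size j.+1 P t.
  rewrite /M !updateE !addr_inj /=; try lia.
  rewrite /count_size big_ord_recr /= -/(count_size j P t) eq_sym.
  by case: eqP => [->|_]; rewrite ?(jr_count jr) ?addn0 ?addn1.
have M2 r i : 1 < r < m + 4 -> M (ad r i) = 0.
  move=> rm; rewrite /M !updateE !addr_inj; try lia.
  have -> : (r == 1) = false by lia.
  have -> : (r == 0) = false by lia.
  exact: (jr_rest jr).
apply: runs_seq_max.
apply: (@runs_post _ _ _ _ (fun s' => [/\ mem s' = M,
   regs s' r_p = maxn (max_proc j) (P j) &
   forall x, x <> r_p -> x <> r_t -> regs s' x = regs s x])).
  apply: runs_if_max => // e.
    apply: runs_assign => //; split=> // [|x x1 x2]; rewrite /= !updateE /=.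
      by move: e; rewrite /= !updateE /= (jr_p jr); lia.
    by do ![case: eqP => // _].
  apply: runs_skip => //; split=> // [|x x1 x2]; rewrite /= !updateE /=.
    by move: e; rewrite /= !updateE /= (jr_p jr); lia.
  by do ![case: eqP => // _].
move=> s' [eM ep er]; apply: runs_assign => //.
  by rewrite /= er // (jr_j jr); lia.
split=> [||||||a|j'|t|r i]; rewrite /= ?updateE /= ?eM //.
- by rewrite er // (jr_n jr).
- by rewrite er // (jr_off jr).
- by rewrite ep /max_proc big_ord_recr.
- by rewrite er // (jr_j jr) addn1.
- by rewrite er // (jr_K jr).
- by rewrite er // (jr_bden jr).
- exact: Mlow.
- exact: M0.
- exact: M2.
Qed.

Lemma runs_read_input s : s = State (fun=> 0) mem0 ->
  runs X (read_input m) s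
    (max_cost (r_n ::= Read (Const 0)) +
     (max_cost (r_off ::= Reg r_n [+] Const (3 * m + 1)) +
      n.+1 * (max_cost (read_job m) + 4))) (jobs_read n).
Proof.
move=> ->; apply: runs_seq; apply: runs_assign => //.
  by rewrite /= (input_n inp); lia.
rewrite /= (input_n inp); apply: runs_seq; apply: runs_assign => //.
set s1 := State _ _.
pose Inv r s := exists j, [/\ jobs_read j s & j + r = n].
apply: (@runs_while _ X2 _ _ Inv).
- move=> r s2 [j [jr e]]; rewrite /= (jr_j jr) (jr_n jr) => lt.
  have jn : j < n by move: lt; case: (j < n).
  exists r.-1; first by lia.
  apply: runs_weaken (runs_read_job jr jn) _ _ => // s' jr'.
  by exists j.+1; split=> //; lia.
- move=> r s2 [j [jr e]]; rewrite /= (jr_j jr) (jr_n jr) => lt.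
  by have <- : j = n by [lia].
exists 0; split=> //; split=> //.
- by rewrite /max_proc big_ord0.
- move=> t; rewrite /count_size big_ord0; apply: (input_end inp); exact: addr_ge.
- move=> r i _; apply: (input_end inp); exact: addr_ge.
Qed.
Notation p := (max_proc n).
Notation c := (count_size n P).
Notation constants K := (constants m n p K P c num den cap).

Record powers_stored k s : Prop := PowersStored {
  ps_n : regs s r_n = n;
  ps_off : regs s r_off = off m n;
  ps_p : regs s r_p = p;
  ps_K : regs s r_K = k;
  ps_v : regs s r_v = 2 ^ k;
  ps_bden : regs s r_bden = 0;
  ps_input : forall a, a < off m n -> mem s a = mem0 a;
  ps_proc : forall j, j < n -> mem s (ad a_proc j) = P j;
  ps_count : forall t, mem s (ad a_count t) = c t;
  ps_pow : forall k', k' <= k -> mem s (ad a_pow k') = 2 ^ k';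
  ps_rest : forall r i, 2 < r < m + 4 -> mem s (ad r i) = 0 }.

Lemma runs_next_pow k s : powers_stored k s -> 2 ^ k <= n ->
  runs X (next_pow m) s (max_cost (next_pow m)) (powers_stored k.+1).
Proof.
move=> ps kn; have kX : k.+1 <= X by have := ltn_expl k (ltnSn 1); lia.
apply: runs_seq_max; apply: runs_assign => //.
  by rewrite /= (ps_v ps); apply: leq_trans n_le; rewrite mulnC leq_mul2l.
rewrite /= (ps_v ps) -expnSr; apply: runs_seq_max; apply: runs_assign => //.
  by rewrite /= !updateE /= (ps_K ps) addn1.
rewrite /= !updateE /= (ps_K ps) addn1.
apply: (runs_put (off := off m n)) => //; first exact: ps_off ps.
  by rewrite /= !updateE /= expnS; apply: leq_trans n_le; rewrite leq_mul2l.
rewrite /= !updateE /=.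
split=> [||||||a lt|j jn|t|k' kk|r i rm]; rewrite /= ?updateE /=.
- exact: ps_n ps.
- exact: ps_off ps.
- exact: ps_p ps.
- by [].
- by [].
- exact: ps_bden ps.
- case: eqP => [ea|_]; first by rewrite ea ltnNge addr_ge in lt.
  exact: (ps_input ps).
- rewrite addr_inj /=; try lia; exact: (ps_proc ps).
- rewrite addr_inj /=; try lia; exact: (ps_count ps).
- rewrite addr_inj /=; try lia; case: eqP => [->//|e].
  by apply: (ps_pow ps); lia.
- rewrite addr_inj /=; try lia; have -> : (r == 2) = false by lia.
  exact: (ps_rest ps).
Qed.

Definition set_constants_time L :=
  max_cost (r_v ::= Const 1) + (max_cost (put m a_pow (Const 0) (Const 1)) +
  (L.+1 * (max_cost (next_pow m) + 6) +
   (max_cost (r_M ::= (Reg r_p [+] Const 1) [*] Const m [+] Const 1) +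
   (max_cost (r_A ::= Const 2 [*] ((Reg r_M [-] Const 1) [*] (Reg r_p [+] Const 1)) [+] Const 2) +
   (max_cost (r_S ::= powE (Reg r_A) (2 * m)) +
   (max_cost (r_N ::= Reg r_K [*] Reg r_M) +
    max_cost (r_bnum ::= Const 1))))))).

Hypothesis cells_le : (nrows m p n).+1 * nstates m p <= X.

Lemma nrows_le K : K <= n -> (nrows m p K).+1 * nstates m p <= X.
Proof.
by move=> Kn; apply: leq_trans cells_le; rewrite leq_mul2r ltnS /nrows leq_mul2r Kn !orbT.
Qed.

Record ready K s : Prop := Ready {
  ready_const : constants K s;
  ready_bnum : regs s r_bnum = 1;
  ready_bden : regs s r_bden = 0;
  ready_mult : forall i t, i < m -> mem s (ad (a_mult i) t) = 0 }.

(** [K <= L] serves the time bound, [K <= n] the word size, and [n < 2 ^ K] ensures that no bundles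
    are left at level [K]. *)
Lemma runs_set_constants L s : n < 2 ^ L -> jobs_read n s ->
  runs X (set_constants m) s (set_constants_time L) (fun s' =>
    exists K, [/\ K <= L, K <= n, n < 2 ^ K & ready K s']).
Proof.
move=> nL jr; apply: runs_seq; apply: runs_assign => //; first by rewrite /=; lia.
rewrite /=; apply: runs_seq; apply: (runs_put (off := off m n)) => //.
- exact: jr_off jr.
- by rewrite /=; lia.
rewrite /=; set s1 := State _ _.
have ps1 : powers_stored 0 s1.
  split=> [||||||a lt|j jn|t|k' kk|r i rm]; rewrite /s1 /= ?updateE /=.
  - exact: jr_n jr.
  - exact: jr_off jr.
  - exact: jr_p jr.
  - exact: jr_K jr.
  - by [].
  - exact: jr_bden jr.
  - case: eqP => [ea|_]; first by rewrite ea ltnNge addr_ge in lt.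
    exact: (jr_input jr).
  - rewrite addr_inj /=; try lia; exact: (jr_proc jr).
  - rewrite addr_inj /=; try lia; exact: (jr_count jr).
  - by rewrite addr_inj /=; try lia; case: eqP => [->//|e]; lia.
  - rewrite addr_inj /=; try lia; have -> : (r == 2) = false by lia.
    by apply: (jr_rest jr); lia.
pose Inv r s' := exists k, [/\ powers_stored k s', k + r = L & k <= n].
pose post s' := exists K, [/\ K <= L, K <= n, n < 2 ^ K & powers_stored K s'].
apply: runs_seq; apply: (@runs_post _ _ _ _ post).
  apply: (@runs_while _ X2 _ _ Inv).
  - move=> r s2 [k [ps e kn]]; rewrite /= (ps_v ps) (ps_n ps) addn1 ltnS => /eqP.
    rewrite eqb0 negbK => le; have kL : k < L.
      by rewrite -(ltn_exp2l k L (ltnSn 1)); apply: leq_ltn_trans nL.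
    exists r.-1; first by lia.
    apply: runs_post (runs_next_pow ps le) _ => s3 ps3; exists k.+1; split=> //; first by lia.
    by apply: leq_trans le; apply: ltn_expl.
  - move=> r s2 [k [ps e kn]]; rewrite /= (ps_v ps) (ps_n ps) addn1 ltnS => /eqP.
    by rewrite eqb0 -ltnNge => lt; exists k; split=> //; lia.
  by exists 0; split.
move=> s2 [K [KL Kn nK ps]].
have cX := nrows_le Kn; have S0 := nstates_gt0 m p.
have AS : base m p <= nstates m p.
  by rewrite /nstates -{1}[base m p]expn1 leq_exp2l ?/base; lia.
have SX : nstates m p <= X by apply: leq_trans cX; rewrite leq_pmull.
have MA : (nslots m p).+1 <= base m p by rewrite /base; nia.
apply: runs_seq; apply: runs_assign => //.
  by rewrite /= (ps_p ps) !addn1; apply: leq_trans MA (leq_trans AS SX).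
rewrite /= (ps_p ps) !addn1; apply: runs_seq; apply: runs_assign => //.
  by rewrite /= !updateE /= (ps_p ps) addn1 subn1 /= -/(nslots m p); apply: leq_trans SX.
rewrite /= !updateE /= (ps_p ps) addn1 subn1 /= -/(nslots m p) -/(base m p).
apply: runs_seq; apply: runs_assign => //; first by rewrite eval_powE.
rewrite eval_powE [eval _ _]/= -/(nstates m p).
apply: runs_seq; apply: runs_assign => //.
  rewrite /= !updateE /= (ps_K ps) -/(nslots m p) -/(nrows m p K).
  by apply: leq_trans cX; nia.
rewrite /= !updateE /= (ps_K ps) -/(nslots m p) -/(nrows m p K).
apply: runs_assign => //; first by rewrite /=; lia.
have low a : a < off m n -> mem s2 a = mem0 a by apply: (ps_input ps).
exists K; split=> //; split=> //.
  split=> //=; rewrite ?updateE /=.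
  - exact: ps_n ps.
  - exact: ps_p ps.
  - exact: ps_off ps.
  - exact: ps_K ps.
  - by move=> i im; rewrite low ?(input_num inp) // /off; lia.
  - by move=> i im; rewrite low ?(input_den inp) // /off; lia.
  - by move=> i im; rewrite low ?(input_cap inp) // /off; lia.
  - exact: ps_proc ps.
  - exact: ps_count ps.
  - exact: ps_pow ps.
  exact: ps_bden ps.
by move=> i t im; apply: (ps_rest ps); lia.
Qed.

End Input.

(** * Binary search for the best achievable makespan *)

Section Solving.
Variables (m n p K : nat) (P num den cap : nat -> nat).
Hypotheses (m_gt0 : 0 < m).
Hypothesis num_gt0 : forall i, i < m -> 0 < num i.

Notation ad := (addr m (off m n)).
Notation c := (count_size n P).
Notation constants := (constants m n p K P c num den cap).

Definition achievable a b := splittable m p c (budget m cap (max_load num den a b)).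

Lemma achievable_le a a' b : a <= a' -> achievable a b -> achievable a' b.
Proof.
move=> le; apply: (splittable_le m_gt0) => j _; rewrite /budget.
by case: ifP => // _; rewrite /max_load leq_div2r // leq_mul2r le orbT.
Qed.

Variables (X D : nat).
Hypothesis X2 : 1 < X.
Hypothesis cells_le : (nrows m p K).+1 * nstates m p <= X.
Hypothesis c_lt : forall t, t < p.+1 -> c t < 2 ^ K.
Hypotheses (num_le : forall i, i < m -> num i <= D)
  (den_le : forall i, i < m -> den i <= D).
Hypothesis makespans_le : (n * p).+1 * D * D <= X.

Lemma table_answer U s : table_ok m n p K c cap U s 0 ->
  mem s (ad a_table 0) <> 0 <-> splittable m p c (budget m cap U).
Proof.
move=> tab; have := tab 0 0 (fun=> 0) isT isT (fun _ _ => conj isT isT) isT.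
have -> : cell m p 0 0 (fun=> 0) = 0 by rewrite /cell /enc big1.
move=> h; apply: iff_trans h _; apply: iff_trans (completable0 p c m_gt0 _ _) _.
have slackE j : slack m cap U 0 (fun=> 0) j = budget m cap U j.
  by rewrite /slack /level divn1 subn0.
split=> -[z z1 z2]; exists z => [t tp|]; rewrite ?z1 // ?(cnt0 _ m_gt0) //.
  by apply: (within_le m_gt0) z2 => // j jm; rewrite slackE.
by apply: (within_le m_gt0) z2 => // j jm; rewrite slackE.
Qed.

(* Fractions are compared by cross-multiplication; 1 / 0 stands for infinity. *)
Definition dominated s (a : nat) := forall w, w <= n * p ->
  achievable (w * den a) (num a) ->
  regs s r_bnum * num a <= w * den a * regs s r_bden.

Record searching (done : pred nat) s0 s : Prop := Searching {
  sr_const : constants s;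
  sr_mem : forall a, (forall i, a <> ad a_table i) -> mem s a = mem s0 a;
  sr_best : regs s r_bnum = 1 /\ regs s r_bden = 0 \/
    [/\ 0 < regs s r_bden, regs s r_bden <= D &
        regs s r_bnum <= (n * p).+1 * D /\
        achievable (regs s r_bnum) (regs s r_bden)];
  sr_dominated : forall a, done a -> a < m -> dominated s a }.

Definition probe_time a :=
  max_cost (r_num ::= (Reg r_lo [+] Reg r_hi) [/] Const 2 [*] Read (Const (3 * a + 2))) +
  (max_cost (r_den ::= Read (Const (3 * a + 1))) +
  (decide_time m p K +
   max_cost (If (get m a_table (Const 0))
    (r_hi ::= (Reg r_lo [+] Reg r_hi) [/] Const 2 ;;
     If (Reg r_num [*] Reg r_bden [<] Reg r_bnum [*] Reg r_den)
       (r_bnum ::= Reg r_num ;; r_bden ::= Reg r_den) Skip)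
    (r_lo ::= (Reg r_lo [+] Reg r_hi) [/] Const 2 [+] Const 1)))).

(** Each probe halves the gap, so [r] is the variant. [br_found] is conditional because the initial
    [r_hi] has not been tested. *)
Record bracketing done s0 a r s : Prop := Bracketing {
  br_searching : searching done s0 s;
  br_hi : regs s r_hi <= (n * p).+1;
  br_gap : regs s r_hi - regs s r_lo < 2 ^ r;
  br_below : forall w, w < regs s r_lo -> ~ achievable (w * den a) (num a);
  br_found : regs s r_hi <= n * p ->
    regs s r_bnum * num a <= regs s r_hi * den a * regs s r_bden }.

Lemma runs_probe done s0 a r s : a < m ->
  bracketing done s0 a r s -> regs s r_lo < regs s r_hi ->
  exists2 r', r = r'.+1 &
    runs X (probe m a) s (probe_time a) (bracketing done s0 a r').
Proof.
move=> am [[cs ms best dom] hi gap below found] lohi.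
case: r gap => [|r] gap; first by rewrite expn0 in gap; lia.
exists r => //; set lo := regs s r_lo in gap below lohi.
set h := regs s r_hi in hi gap found lohi; set mid := (lo + h) %/ 2.
have mid_lt : lo <= mid < h by rewrite /mid; lia.
have gap1 : mid - lo < 2 ^ r by move: gap; rewrite expnS /mid; lia.
have gap2 : h - mid.+1 < 2 ^ r by move: gap; rewrite expnS /mid; lia.
have denD := den_le am; have numD := num_le am.
have aX : mid * den a <= (n * p).+1 * D.
  by apply: leq_mul => //; lia.
have D0 : 0 < D by apply: leq_trans numD; apply: num_gt0.
have DX : (n * p).+1 * D <= X by apply: leq_trans makespans_le; rewrite leq_pmulr.
have npX : (n * p).+1 <= X by apply: leq_trans DX; rewrite leq_pmulr.
apply: runs_seq; apply: runs_assign => //.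
  by rewrite /= (const_den cs) // -/lo -/h -/mid; apply: leq_trans DX.
rewrite [eval _ _]/= (const_den cs) // -/lo -/h -/mid.
apply: runs_seq; apply: runs_assign => //.
  by rewrite /= (const_num cs) //; apply: leq_trans numD _; nia.
rewrite [eval _ _]/= (const_num cs) //; set s1 := State _ _.
have cs1 : constants s1 by case: cs.
have UX i : i < m -> max_load num den (mid * den a) (num a) i <= X.
  move=> im; apply: leq_trans (leq_div _ _) _; apply: leq_trans makespans_le.
  by apply: leq_mul => //; apply: num_le.
apply: runs_seq; apply: runs_post (runs_decide m_gt0 X2 cells_le c_lt cs1 _ _ UX) _ => //.
move=> s2 [cs2 bs2 low2 mem2 /table_answer ans].
rewrite -/(achievable _ _) in ans.
have lo2 : regs s2 r_lo = lo by rewrite low2.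
have h2 : regs s2 r_hi = h by rewrite low2.
have bn2 : regs s2 r_bnum = regs s r_bnum by rewrite low2.
have bd2 : regs s2 r_bden = regs s r_bden by rewrite low2.
have n2 : regs s2 r_num = mid * den a by rewrite low2.
have d2 : regs s2 r_den = num a by rewrite low2.
have ms2 a' : (forall i, a' <> ad a_table i) -> mem s2 a' = mem s0 a'.
  by move=> h'; rewrite mem2 // -ms.
have cs_upd s3 : mem s3 = mem s2 -> (forall x, x < 8 -> regs s3 x = regs s2 x) ->
    constants s3.
  by case: cs2 => ? ? ? ? ? ? ? ? ? ? ? ? ? ? e1 e2; split; rewrite ?e2 // ?e1.
apply: runs_if_max => // e.
  have ach : achievable (mid * den a) (num a).
    by apply/ans; move: e; rewrite (eval_get _ _ _ (const_off cs2)).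
  apply: runs_seq_max; apply: runs_assign => //.
    by rewrite /= lo2 h2 -/mid; lia.
  rewrite [eval _ _]/= lo2 h2 -/mid; apply: runs_if_max => //.
    rewrite /= !updateE /= n2 d2 bn2 bd2 => /eqP; rewrite eqb0 negbK => better.
    apply: runs_seq_max; apply: runs_assign => //.
      by rewrite /= updateE /= n2; apply: leq_trans DX.
    rewrite /= updateE /= n2; apply: runs_assign => //.
      by rewrite /= !updateE /= d2; apply: leq_trans numD _; nia.
    rewrite /= !updateE /= d2; set s3 := State _ _.
    have bn3 : regs s3 r_bnum = mid * den a by [].
    have bd3 : regs s3 r_bden = num a by [].
    (* Transitivity of the comparison of fractions, by cancelling the old denominator. If the old
       value is 1 / 0, the premise forces x = 0. *)
    have improve x y : regs s r_bnum * x <= y * regs s r_bden ->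
        mid * den a * x <= y * num a.
      move=> le; case: best => [[b1 b0]|[b0 _ _]].
        by move: le; rewrite b1 b0; nia.
      rewrite -(leq_pmul2r b0) mulnAC; nia.
    split=> //; rewrite ?bn3 ?bd3.
    + split=> //.
      * by apply: cs_upd => // x x8; rewrite /s3 /= !updateE; do !case: eqP => // ?; lia.
      * by right; rewrite bn3 bd3; split=> //; apply: num_gt0.
      * move=> a' da' am' w wnp wa; rewrite bn3 bd3; apply: improve.
        exact: dom.
    + by rewrite /s3 /= !updateE /=; lia.
    + by rewrite /s3 /= !updateE /= lo2.
    + by rewrite /s3 /= !updateE /= lo2.
  rewrite /= !updateE /= n2 d2 bn2 bd2 => /eqP; rewrite eqb0 -leqNgt => worse.
  apply: runs_skip; set s3 := State _ _.
  have bn3 : regs s3 r_bnum = regs s r_bnum by [].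
  have bd3 : regs s3 r_bden = regs s r_bden by [].
  split=> //.
  + split=> //; rewrite ?bn3 ?bd3 //.
      by apply: cs_upd => // x x8; rewrite /s3 /= !updateE; case: eqP => // ?; lia.
    by move=> a' da' am' w; rewrite bn3 bd3; apply: dom.
  + by rewrite /s3 /= !updateE /=; lia.
  + by rewrite /s3 /= !updateE /= lo2.
  + by rewrite /s3 /= !updateE /= lo2.
  + by rewrite bn3 bd3 /s3 /= !updateE.
have nach : ~ achievable (mid * den a) (num a).
  by move=> /ans; move: e; rewrite (eval_get _ _ _ (const_off cs2)).
apply: runs_assign => //; first by rewrite /= lo2 h2 -/mid; lia.
rewrite [eval _ _]/= lo2 h2 -/mid addn1; set s3 := State _ _.
have bn3 : regs s3 r_bnum = regs s r_bnum by [].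
have bd3 : regs s3 r_bden = regs s r_bden by [].
have h3 : regs s3 r_hi = h by [].
split=> //; rewrite ?h3 //.
+ split=> //; rewrite ?bn3 ?bd3 //.
    by apply: cs_upd => // x x8; rewrite /s3 /= !updateE; case: eqP => // ?; lia.
  by move=> a' da' am' w; rewrite bn3 bd3; apply: dom.
+ rewrite /s3 /= !updateE /= => w; rewrite ltnS => wmid wa; apply: nach.
  by apply: achievable_le wa; rewrite leq_mul2r wmid orbT.
+ by rewrite bn3 bd3.
Qed.

Variable R : nat.
Hypothesis R_le : (n * p).+1 < 2 ^ R.

(** Constants cost one operation whatever their value, so [probe_time 0] is convertible to
    [probe_time a] and serves all machines. *)
Definition bisect_time :=
  max_cost (r_lo ::= Const 0) +
  (max_cost (r_hi ::= Reg r_n [*] Reg r_p [+] Const 1) +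
   R.+1 * (probe_time 0 + 4)).
Definition search_time k := k * bisect_time + 1.

Lemma runs_search l (done : pred nat) s0 s : (forall a, a \in l -> a < m) ->
  searching done s0 s ->
  runs X (search m l) s (search_time (size l))
    (searching (fun a => done a || (a \in l)) s0).
Proof.
elim: l done s => [|a l IH] done s lm sr.
  apply: runs_skip; case: sr => cs ms best dom; split=> // a.
  by rewrite in_nil orbF; apply: dom.
have am : a < m by apply: lm; rewrite mem_head.
have D0 : 0 < D by apply: leq_trans (num_le am); apply: num_gt0.
have npX : (n * p).+1 <= X.
  by apply: leq_trans makespans_le; rewrite -mulnA leq_pmulr // muln_gt0 D0.
have [cs ms best dom] := sr.
rewrite /search_time [size _]/= mulSn -addnA -/(search_time (size l)) /bisect_time.
rewrite -(addnA (max_cost (r_lo ::= _))) -(addnA (max_cost (r_hi ::= _))).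
set pt := probe_time 0.
apply: runs_seq; apply: runs_assign => //.
rewrite /=; apply: runs_seq; apply: runs_assign => //.
  by rewrite /= !updateE /= (const_n cs) (const_p cs) addn1.
rewrite /= !updateE /= (const_n cs) (const_p cs) addn1; set s1 := State _ _.
have sr1 : searching done s0 s1.
  split=> //; case: cs => *; split; rewrite /s1 /= ?updateE //=.
apply: runs_seq; apply: (@runs_post _ _ _ _
    (searching (fun b => done b || (b == a)) s0)).
  apply: (@runs_while _ X2 _ _ (bracketing done s0 a)).
  - move=> r s2 br; rewrite /= => /eqP; rewrite eqb0 negbK => lt.
    by have [r' -> run] := runs_probe am br lt; exists r'.
  - move=> r s2 [[cs2 ms2 best2 dom2] hi gap below found].
    rewrite /= => /eqP; rewrite eqb0 -leqNgt => le; split=> // b.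
    case/orP => [|/eqP ->]; first exact: dom2.
    (* The bracket has closed, so an achievable [w] is at least [r_lo] and hence at least [r_hi];
       together with [w <= n * p] this makes [br_found] applicable. *)
    move=> _ w wnp wa; have hw : regs s2 r_hi <= w.
      by rewrite leqNgt; apply/negP => lt; case: (below w) => //; lia.
    have f := found (leq_trans hw wnp); apply: leq_trans f _.
    by rewrite !leq_mul2r hw !orbT.
  split=> //; rewrite /s1 /= !updateE //=; by rewrite ltnn.
move=> s2 sr2; have lm' b : b \in l -> b < m.
  by move=> bl; apply: lm; rewrite inE bl orbT.
apply: runs_post (IH _ s2 lm' sr2) _ => s3 [cs3 ms3 best3 dom3].
by split=> // b; rewrite inE orbA; apply: dom3.
Qed.

End Solving.

(** * Turning multiplicities into a schedule *)

Section Output.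
Variables (m n p K : nat) (P num den cap : nat -> nat).
Hypotheses (m_gt0 : 0 < m) (P_le : forall j, j < n -> P j <= p).

Notation ad := (addr m (off m n)).
Notation c := (count_size n P).
Notation constants := (constants m n p K P c num den cap).
Notation mult' := (mult m n).

Variables (X : nat) (s0 : state).
Hypothesis X2 : 1 < X.
Hypotheses (cs0 : constants s0) (m_le : m <= X) (n_le : n < X).
Hypothesis mult_sum : forall t, t < p.+1 -> \sum_(i < m) mult' s0 i t = c t.

Record printed (j : nat) sg s : Prop := Printed {
  pr_n : regs s r_n = n;
  pr_off : regs s r_off = off m n;
  pr_j : regs s r_j = j;
  pr_proc : forall j', j' < n -> mem s (ad a_proc j') = P j';
  pr_machine : forall j', j' < n -> sg j' < m;
  pr_cells : forall j', j' < j -> mem s j'.+1 = sg j';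
  pr_mult : forall i t, i < m ->
    mult' s i t + \sum_(j' < j) (sg j' == i) * (P j' == t) = mult' s0 i t }.

Lemma runs_output_job j s : (exists sg, printed j sg s) -> j < n ->
  runs X (output_job m) s (max_cost (output_job m))
    (fun s' => exists sg, printed j.+1 sg s').
Proof.
move=> [sg pr] jn; apply: runs_bounded => -[bR bM].
have tp : P j < p.+1 by apply: P_le.
have et : eval s (get m a_proc (Reg r_j)) = P j.
  by rewrite (eval_get _ _ _ (pr_off pr)) [eval _ _]/= (pr_j pr) (pr_proc pr).
apply: runs_seq_max; apply: runs_assign => //.
  by rewrite (eval_get _ _ _ (pr_off pr)).
rewrite et; set s1 := State _ _.
have off1 : regs s1 r_off = off m n by apply: pr_off pr.
have test i : eval s1 (get m (a_mult i) (Reg r_t)) = mult' s i (P j).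
  by rewrite (eval_get _ _ _ off1).
(* Were all quotas of this size used up, the first [j] jobs would already contain all jobs of the
   size of job [j]. *)
have [i0 i0m mi0] : exists2 i0, i0 < m & mult' s i0 (P j) <> 0.
  suff: [exists i : 'I_m, mult' s i (P j) != 0].
    by case/existsP=> i /eqP h; exists i.
  apply: contraT => /existsPn h.
  have e0 (i : 'I_m) : true -> mult' s0 i (P j) = count_class j P sg i (P j).
    by rewrite -(pr_mult pr) //; have := h i; rewrite negbK => /eqP ->.
  have sgm j' : j' < j -> sg j' < m by move=> lt; apply: (pr_machine pr); lia.
  have := mult_sum tp; rewrite (eq_bigr _ e0) (count_size_class P _ sgm) => e1.
  by have := count_size_lt P jn; rewrite -e1 ltnn.
pose post i s' := i < m /\
  s' = State (regs s1) (update (update (mem s1) (ad (a_mult i) (P j))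
         (mult' s i (P j) - 1)) j.+1 i) /\ mult' s i (P j) <> 0.
apply: runs_seq_max; apply: (@runs_post _ _ _ _ (fun s' => exists i, post i s')).
  apply: runs_first_of => // [i|none].
    rewrite mem_iota add0n test => im mi.
    have ev : eval s1 (get m (a_mult i) (Reg r_t) [-] Const 1) = mult' s i (P j) - 1.
      by rewrite -(test i).
    apply: runs_seq_max; apply: (runs_put X2 off1); rewrite ev.
      exact: leq_trans (leq_subr _ _) (bM _).
    have -> : eval s1 (Reg r_t) = P j by [].
    apply: runs_write => //; first by rewrite /=; lia.
    by exists i; split=> //; split=> //; rewrite [eval _ (Const _)]/= [eval _ _]/= /s1 /= !updateE /= (pr_j pr) addn1.
  by case: mi0; rewrite -test; apply: none; rewrite mem_iota.
move=> s2 [i [im [-> mi]]]; apply: runs_assign => //.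
  by rewrite /= !updateE /= (pr_j pr); lia.
rewrite /= !updateE /= (pr_j pr) addn1.
exists (fun j' => if j' == j then i else sg j').
(* Output cells end at n, below [off], where the arrays start. *)
have jlow r i' : j.+1 <> ad r i'.
  by have := addr_ge m (off m n) r i'; rewrite /off; lia.
split=> [||||j' j'n|j' j'j|i' t im'] //=.
- exact: pr_n pr.
- move=> j' j'n; rewrite updateE [_ == j.+1]eq_sym; case: eqP => [/jlow//|_].
  rewrite updateE addr_inj /=; try lia; exact: (pr_proc pr).
- by case: eqP => // _; apply: (pr_machine pr).
- rewrite updateE eqSS; case: eqP => // ne; rewrite updateE.
  case: eqP => [e|_]; last by apply: (pr_cells pr); lia.
  by have := addr_ge m (off m n) (a_mult i) (P j); rewrite -e /off; lia.
- rewrite big_ord_recr /= eqxx.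
  under eq_bigr => j' _ do rewrite (ltn_eqF (ltn_ord j')).
  rewrite -(pr_mult pr t im') /mult /= updateE [_ == j.+1]eq_sym; case: eqP => [/jlow//|_].
  rewrite updateE addr_inj; [|lia|lia]; rewrite eqn_add2l /s1 /= -!/(mult' _ _ _).
  rewrite [i == i']eq_sym [P j == t]eq_sym.
  case: (i' =P i) => [->|_]; last by rewrite /= mul0n addn0.
  case: (t =P P j) => [->|_] /=; last by rewrite muln0 addn0.
  by gen_sums; lia.
Qed.

Definition output_time :=
  max_cost (r_j ::= Const 0) + (n.+1 * (max_cost (output_job m) + 4) +
   max_cost (Write (Const 0) (Const 1))).

Lemma runs_output : runs X (output m) s0 output_time (fun s =>
  mem s 0 = 1 /\ exists sg : nat -> nat,
    [/\ forall j, j < n -> sg j < m,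
        forall j, j < n -> mem s j.+1 = sg j
      & forall i t, i < m -> count_class n P sg i t <= mult' s0 i t]).
Proof.
apply: runs_seq; apply: runs_assign => //.
rewrite [eval _ _]/=; set s1 := State _ _.
pose Inv r s := exists j, (exists sg, printed j sg s) /\ j + r = n.
apply: runs_seq; apply: (@runs_post _ _ _ _ (fun s => exists sg, printed n sg s)).
  apply: (@runs_while _ X2 _ _ Inv).
  - move=> r s [j [[sg pr] e]]; rewrite /= (pr_j pr) (pr_n pr) => /eqP.
    rewrite eqb0 negbK => jn; exists r.-1; first by lia.
    apply: runs_post (runs_output_job _ jn) _; first by exists sg.
    by move=> s' pr'; exists j.+1; split=> //; lia.
  - move=> r s [j [[sg pr] e]]; rewrite /= (pr_j pr) (pr_n pr) => /eqP.
    by rewrite eqb0 => jn; exists sg; have <- : j = n by [lia].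
  exists 0; split=> //; exists (fun=> 0); split=> //.
  - exact: const_n cs0.
  - exact: const_off cs0.
  - exact: const_proc cs0.
  - by move=> i t im; rewrite big_ord0 addn0.
move=> s [sg pr]; apply: runs_write => //=; first by lia.
split=> //; exists sg; split=> [||i t im].
- exact: pr_machine pr.
- exact: pr_cells pr.
- by rewrite -(pr_mult pr t im) leq_addl.
Qed.

End Output.

Section Solve.
Variables (m n : nat) (P num den cap mem0 : nat -> nat) (X D L R : nat).
Hypotheses (m_gt0 : 0 < m) (n_gt0 : 0 < n)
  (inp : input_memory m n P num den cap mem0)
  (num_gt0 : forall i, i < m -> 0 < num i)
  (num_le : forall i, i < m -> num i <= D)
  (den_le : forall i, i < m -> den i <= D).
Notation p := (max_proc P n).
Notation c := (count_size n P).
Notation ad := (addr m (off m n)).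
Notation achievable := (achievable m n p P num den cap).
Hypotheses (X2 : 1 < X) (n_le : 2 * n <= X) (off_le : off m n <= X)
  (cells_le : (nrows m p n).+1 * nstates m p <= X)
  (makespans_le : (n * p).+1 * D * D <= X)
  (nL : n < 2 ^ L) (npR : (n * p).+1 < 2 ^ R).

Lemma proc_le j : j < n -> P j <= p.
Proof. by move=> jn; apply: (leq_bigmax (Ordinal jn)). Qed.

Definition read_time :=
  max_cost (r_n ::= Read (Const 0)) +
  (max_cost (r_off ::= Reg r_n [+] Const (3 * m + 1)) +
   n.+1 * (max_cost (read_job m) + 4)).

Definition final_time K :=
  (cost (Reg r_bden)).+1 +
  (max_cost (r_num ::= Reg r_bnum) + (max_cost (r_den ::= Reg r_bden) +
   (decide_time m p K + (walk_time m p K + output_time m n)))).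

Definition solve_time :=
  read_time + (set_constants_time m L +
    (search_time m p L R m + final_time L)).

Lemma decide_time_le K : K <= L -> decide_time m p K <= decide_time m p L.
Proof.
move=> KL; rewrite leq_add2l leq_add2l leq_mul2r ltnS leq_mul2r ltnS.
by rewrite leq_mul2r KL !orbT.
Qed.

Lemma search_time_le K : K <= L -> search_time m p K R m <= search_time m p L R m.
Proof.
move=> KL; rewrite leq_add2r leq_mul2l !leq_add2l leq_mul2l leq_add2r.
by rewrite !leq_add2l leq_add2r decide_time_le // !orbT.
Qed.

Lemma final_time_le K : K <= L -> final_time K <= final_time L.
Proof.
move=> KL; rewrite !leq_add2l leq_add ?decide_time_le // leq_add2r.
by rewrite leq_add2l leq_mul2r ltnS leq_mul2r KL !orbT.
Qed.

(** Correctness in natural numbers: a / b bounds the loads of the printed schedule and is at most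
    every achievable candidate w / q_i, by cross-multiplication. *)
Definition solution s :=
  mem s 0 = 1 /\ (exists sg a b,
    [/\ 0 < b, forall j, j < n -> sg j < m /\ mem s j.+1 = sg j,
        forall i, i < m -> work n P sg i <= max_load num den a b i /\
                           number n sg i <= cap i
      & forall i w, i < m -> w <= n * p -> achievable (w * den i) (num i) ->
          a * num i <= w * den i * b]) \/
  mem s 0 = 0 /\
    (forall i w, i < m -> w <= n * p -> ~ achievable (w * den i) (num i)).

Lemma runs_solve :
  runs X (solve m) (State (fun=> 0) mem0) solve_time solution.
Proof.
have D0 : 0 < D by apply: leq_trans (num_gt0 m_gt0) (num_le m_gt0).
have DX : (n * p).+1 * D <= X by apply: leq_trans makespans_le; rewrite leq_pmulr.
have D_le : D <= X by apply: leq_trans DX; rewrite leq_pmull.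
apply: runs_seq; apply: runs_post (runs_read_input m_gt0 n_gt0 inp X2 n_le off_le erefl) _.
move=> s1 jr; apply: runs_seq.
apply: runs_post (runs_set_constants m_gt0 n_gt0 inp X2 n_le off_le cells_le nL jr) _.
move=> s2 [K [KL Kn nK rd]].
have cX : (nrows m p K).+1 * nstates m p <= X by exact: (nrows_le cells_le Kn).
have cs2 := ready_const rd.
have c_lt t : t < p.+1 -> c t < 2 ^ K.
  by move=> _; apply: leq_ltn_trans nK; apply: count_size_le.
have sr2 : searching m n p K P num den cap D pred0 s2 s2.
  by split=> //; left; rewrite (ready_bnum rd) (ready_bden rd).
apply: runs_seq.
have lm a : a \in iota 0 m -> a < m by rewrite mem_iota.
have := runs_search m_gt0 num_gt0 X2 cX c_lt num_le den_le makespans_le npR lm sr2.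
rewrite size_iota => run; apply: runs_weaken run (search_time_le KL) _.
move=> s3 [cs3 ms3 best dom].
have dom' a : a < m -> dominated m n p P num den cap s3 a.
  by move=> am; apply: dom => //; rewrite mem_iota.
apply: (@runs_weaken _ _ _ (final_time K)) (final_time_le KL) (fun s' h => h).
apply: runs_if => //= bden; last first.
  apply: (@runs_weaken _ _ _ (max_cost (Write (Const 0) (Const 0))) _ solution).
  (* An achievable makespan dominated by 1 / 0 would give [num i <= 0]. *)
  - apply: runs_write => //=; rewrite /solution; right; split=> // i w im wnp wa.
    have := dom' i im w wnp wa; case: best => [[e1 e2]|[b0 _ _]].
      by rewrite e1 e2; have := num_gt0 im; lia.
    by rewrite bden in b0.
  - by rewrite /max_cost /=; lia.
  - by [].
case: best => [[_ b0]|[b0 bD [aD ach]]]; first by rewrite b0 in bden.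
set a := regs s3 r_bnum in aD ach dom'; set b := regs s3 r_bden in b0 bD ach dom'.
have UX i : i < m -> max_load num den a b i <= X.
  move=> im; apply: leq_trans (leq_div _ _) _; apply: leq_trans makespans_le.
  by apply: leq_mul => //; apply: num_le.
apply: runs_seq; apply: runs_assign => //; first by apply: leq_trans DX.
rewrite [eval _ _]/= -/a; apply: runs_seq; apply: runs_assign => //.
  by apply: leq_trans D_le.
rewrite [eval _ _]/= -/b; set s4 := State _ _.
have cs4 : constants m n p K P c num den cap s4.
  by case: cs3 => *; split.
apply: runs_seq; apply: runs_post (runs_decide m_gt0 X2 cX c_lt cs4 _ _ UX) _ => //.
move=> s5 [cs5 bs5 low5 mem5 tab5].
(* All probes so far wrote only to the table, so the multiplicities are still zero. *)
have zero5 i t : i < m -> mult m n s5 i t = 0.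
  move=> im; rewrite /mult mem5 => [|i']; last first.
    by apply/eqP; rewrite addr_inj; lia.
  rewrite ms3 => [|i']; last by apply/eqP; rewrite addr_inj; lia.
  exact: (ready_mult rd).
have c_le t : t < p.+1 -> c t <= X.
  by move=> _; apply: leq_trans (count_size_le _ _ _) _; lia.
apply: runs_seq.
apply: runs_post (runs_walk m_gt0 X2 cX c_lt cs5 bs5 tab5 zero5 ach c_le) _.
move=> s6 [f6 sum6 le6].
have cs6 : constants m n p K P c num den cap s6.
  by apply: frame_constants f6 cs5 => //; exact: mult_array_ok.
have mX : m <= X by move: off_le; rewrite /off; lia.
have nX : n < X by lia.
apply: runs_post (runs_output m_gt0 proc_le X2 cs6 mX nX sum6) _.
move=> s7 [out [sg [sgm cells cls]]]; rewrite /solution; left; split=> //.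
exists sg, a, b; split=> //.
- by move=> j jn; split; [apply: sgm | apply: cells].
- move=> i im; have [h1 h2] := le6 i im; split.
    rewrite (work_class proc_le); apply: leq_trans h1; apply: leq_sum => t _.
    by rewrite leq_mul2l cls ?orbT.
  rewrite (number_class proc_le); apply: leq_trans h2; apply: leq_sum => t _.
  exact: cls.
- by move=> i w im; apply: dom'.
Qed.

End Solve.

(** * Correctness *)

Import Order.TTheory GRing.Theory Num.Theory.

Section Encode.

Definition tabulate k (f : 'I_k -> nat) j := nth 0 [seq f i | i <- enum 'I_k] j.

Lemma tabulateE k (f : 'I_k -> nat) (i : 'I_k) : tabulate f i = f i.
Proof. by rewrite /tabulate (nth_map i) ?size_enum_ord // nth_ord_enum. Qed.

Lemma nth_triples (T : Type) (f g h : T -> nat) s t i : i < size s ->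
  let l := flatten [seq [:: f x; g x; h x] | x <- s] ++ t in
  [/\ nth 0 l (3 * i) = nth 0 (map f s) i,
      nth 0 l (3 * i).+1 = nth 0 (map g s) i
    & nth 0 l (3 * i).+2 = nth 0 (map h s) i].
Proof.
elim: s i => // x s IH [|i] //; rewrite [_ < _]ltnS => /IH [e1 e2 e3].
by rewrite mulnS !addSn add0n.
Qed.

Lemma nth_triples_end (T : Type) (f g h : T -> nat) s t i :
  nth 0 (flatten [seq [:: f x; g x; h x] | x <- s] ++ t) (3 * size s + i) =
  nth 0 t i.
Proof. by elim: s => // x s IH; rewrite [size _]/= mulnS !addSn add0n. Qed.

Variables (m : nat) (I : instance m).

Definition job := tabulate (@proc m I).
Definition speed_num := tabulate (fun i => `|numq (speed I i)|%N).
Definition speed_den := tabulate (fun i => `|denq (speed I i)|%N).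
Definition cap := tabulate (capacity I).

Lemma size_encode : size (encode I) = off m (njobs I).
Proof.
rewrite /= size_cat size_map size_enum_ord size_flatten /shape -map_comp.
rewrite (eq_map (_ : _ =1 fun=> 3)) // sumnE big_map big_enum sum_nat_const.
by rewrite card_ord /off; lia.
Qed.

Lemma input_encode : input_memory m (njobs I) job speed_num speed_den cap
  (nth 0 (encode I)).
Proof.
pose s := enum 'I_m; have sm : size s = m by apply: size_enum_ord.
have triples i : i < m -> _ := fun im => nth_triples
  (fun i => `|numq (speed I i)|%N) (fun i => `|denq (speed I i)|%N) (capacity I)
  [seq proc j | j <- enum 'I_(njobs I)] (etrans (congr1 (leq i.+1) sm) im).
split=> // [i im|i im|i im|j jn|a an].
- by rewrite addn1; case: (triples i im).
- by rewrite addn2; case: (triples i im).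
- by rewrite addn3; case: (triples i im).
- by rewrite addn1 addSn -[X in 3 * X]sm [nth _ _ _]nth_triples_end.
- by rewrite nth_default ?size_encode.
Qed.

Lemma nth_le_max (s : seq nat) i : nth 0 s i <= \max_(x <- s) x.
Proof.
have [lt|ge] := ltnP i (size s); last by rewrite nth_default.
by apply: (@leq_bigmax_seq _ s xpredT id) => //; apply: mem_nth.
Qed.

Lemma magnitude_ge : off m (njobs I) <= magnitude I.
Proof. by rewrite -size_encode leq_addr. Qed.

Lemma nth_encode_le a :
  off m (njobs I) + nth 0 (encode I) a <= magnitude I.
Proof. by rewrite -size_encode leq_add2l nth_le_max. Qed.

Lemma max_proc_job : max_proc job (njobs I) = p_max I.
Proof. by apply: eq_bigr => j _; rewrite /job tabulateE. Qed.

Lemma input_le_magnitude : [/\ p_max I < magnitude I, 3 * m + njobs I < magnitude I,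
  forall i, i < m -> speed_num i <= magnitude I
  & forall i, i < m -> speed_den i <= magnitude I].
Proof.
have inp := input_encode; have le a := nth_encode_le a.
have := magnitude_ge; rewrite /off => mag; split.
- rewrite -max_proc_job -[ltnRHS](@prednK) -1?ltnS; last by lia.
  rewrite ltnS; apply/bigmax_leqP => j _; rewrite -(input_proc inp) //.
  by have := le (3 * m + 1 + j); rewrite /off; lia.
- by lia.
- move=> i im; rewrite -(input_num inp) //.
  by apply: leq_trans (leq_addl _ _) (le _).
- move=> i im; rewrite -(input_den inp) //.
  by apply: leq_trans (leq_addl _ _) (le _).
Qed.

Lemma speed_num_gt0 i : i < m -> 0 < speed_num i.
Proof.
move=> im; rewrite -[i]/(nat_of_ord (Ordinal im)) /speed_num tabulateE.
by rewrite absz_gt0 numq_eq0 gt_eqF ?speed_gt0.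
Qed.

Lemma speed_den_gt0 i : i < m -> 0 < speed_den i.
Proof.
move=> im; rewrite -[i]/(nat_of_ord (Ordinal im)) /speed_den tabulateE.
by rewrite absz_gt0 denq_neq0.
Qed.

Lemma speedE (i : 'I_m) :
  speed I i = ((speed_num i)%:R / (speed_den i)%:R)%R.
Proof.
rewrite /speed_num /speed_den !tabulateE -{1}[speed I i]divq_num_den.
rewrite !natr_absz !gtr0_norm ?denq_gt0 //.
by rewrite numq_gt0 speed_gt0.
Qed.

End Encode.

Section Schedules.
Variables (m : nat) (I : instance m).
Notation n := (njobs I).
Notation P := (job I).
Notation num := (speed_num I).
Notation den := (speed_den I).
Notation achievable := (achievable m n (max_proc P n) P num den (cap I)).

Definition represents (sg : nat -> nat) (sigma : schedule I) :=
  forall j : 'I_n, sg j = sigma j.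

Lemma work_schedule sg sigma (i : 'I_m) : represents sg sigma ->
  work n P sg i = \sum_(j | sigma j == i) proc j.
Proof.
move=> e; rewrite big_mkcond; apply: eq_bigr => j _.
by rewrite e /job tabulateE val_eqE; case: eqP; rewrite ?mul1n ?mul0n.
Qed.

Lemma number_schedule sg sigma (i : 'I_m) : represents sg sigma ->
  number n sg i = #|[set j | sigma j == i]|.
Proof.
move=> e; rewrite -sum1_card big_mkcond /=; apply: eq_bigr => j _.
by rewrite inE e val_eqE; case: eqP.
Qed.

Lemma loadE sg sigma (i : 'I_m) : represents sg sigma ->
  load sigma i = ((work n P sg i * den i)%:R / (num i)%:R)%R.
Proof.
move=> e; rewrite /load -mulr_suml -natr_sum -(work_schedule _ e) speedE.
by rewrite invf_div mulrA natrM.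
Qed.

Lemma ler_div_nat (a b c d : nat) : 0 < b -> 0 < d ->
  (a%:R / b%:R <= c%:R / d%:R :> rat)%R = (a * d <= c * b).
Proof.
move=> b0 d0; rewrite ler_pdivrMr ?ltr0n // mulrAC ler_pdivlMr ?ltr0n //.
by rewrite -!natrM ler_nat.
Qed.

(** The work of a machine is an integer, so rounding the load bound down loses nothing. *)
Lemma load_le_frac sg sigma (i : 'I_m) a b : represents sg sigma -> 0 < b ->
  (load sigma i <= a%:R / b%:R)%R = (work n P sg i <= max_load num den a b i).
Proof.
move=> e b0; rewrite (loadE _ e) ler_div_nat ?speed_num_gt0 //.
rewrite /max_load leq_divRL ?muln_gt0 ?b0 ?speed_den_gt0 //.
by rewrite mulnAC mulnA.
Qed.

Lemma exists_represents sigma : exists sg, represents sg sigma.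
Proof.
exists (tabulate (fun j => sigma j : nat)) => j; exact: tabulateE.
Qed.

Lemma feasible_achievable sg sigma a b : represents sg sigma ->
  feasible sigma ->
  (forall i : 'I_m, work n P sg i <= max_load num den a b i) -> achievable a b.
Proof.
move=> e fs ld; have P_le := @proc_le n P.
exists (count_class n P sg) => [t tp|i im].
  apply: count_size_class => j jn.
  by rewrite -[j]/(nat_of_ord (Ordinal jn)) e.
rewrite -(work_class P_le) -(number_class P_le) /budget im ltnNge leq_addr /=.
rewrite addKn -[i]/(nat_of_ord (Ordinal im)); split; first exact: ld.
by rewrite (number_schedule _ e) /cap tabulateE; apply: fs.
Qed.

Lemma load_le_makespan (sigma : schedule I) i :
  (load sigma i <= makespan sigma)%R.
Proof. exact: le_bigmax. Qed.

Lemma makespan_le (sigma : schedule I) (x : rat) : (0 <= x)%R ->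
  (forall i, load sigma i <= x)%R -> (makespan sigma <= x)%R.
Proof. by move=> x0 h; apply: bigmax_le => // i _; apply: h. Qed.

Hypothesis m_gt0 : 0 < m.

(* The makespan of a feasible schedule is the load of its busiest machine i,
   that is, w / q_i for the total processing requirement w put on i. *)
Lemma feasible_critical (tau : schedule I) : feasible tau ->
  exists i w, [/\ w <= n * p_max I, achievable (w * den i) (num i) &
    ((w * den i)%:R / (num i)%:R <= makespan tau)%R] /\ i < m.
Proof.
move=> ft; have [tg e] := exists_represents tau.
pose i0 := Ordinal m_gt0.
case: (@arg_maxP _ _ _ i0 xpredT (load tau) isT) => i _ imax.
exists i, (work n P tg i); split=> //; split.
- apply: leq_trans (_ : \sum_(j < n) p_max I <= _); last first.
    by rewrite sum_nat_const card_ord.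
  apply: leq_sum => j _; rewrite -max_proc_job.
  by apply: leq_trans (proc_le P (ltn_ord j)); case: eqP; rewrite ?mul1n ?mul0n.
- apply: (feasible_achievable e ft) => k.
  rewrite -(load_le_frac _ _ e) ?speed_num_gt0 // -(loadE _ e).
  exact: imax.
- by rewrite -(loadE _ e) load_le_makespan.
Qed.

(** For a feasible [tau] with critical candidate w / q_i, the makespan of the output is at most a /
    b, which is at most w / q_i, which is at most the makespan of [tau]. *)
Lemma solution_correct s :
  solution m n P num den (cap I) s -> correct_output I s.
Proof.
case=> [[m0 [sg [a [b [b0 cells bounds best]]]]]|[m0 none]]; last first.
  right; split=> // -[tau /feasible_critical [i [w [[wn wa _] im]]]].
  by apply: none wa => //; rewrite max_proc_job.
left; split=> //.
pose sigma : schedule I := [ffun j : 'I_n => Ordinal (cells j (ltn_ord j)).1].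
have e : represents sg sigma by move=> j; rewrite ffunE.
exists sigma; split; last by move=> j; rewrite ffunE; apply: (cells j _).2.
split=> [i|tau ft].
  rewrite -(number_schedule _ e); have [_] := bounds i (ltn_ord i).
  by rewrite /cap tabulateE.
have [i [w [[wn wa wt] im]]] := feasible_critical ft.
apply: le_trans wt; apply: makespan_le => [|k].
  by rewrite divr_ge0 ?ler0n.
have [wk _] := bounds k (ltn_ord k); rewrite -(load_le_frac _ _ e) // in wk.
apply: le_trans wk _; rewrite ler_div_nat ?speed_num_gt0 //.
by apply: best wa => //; rewrite max_proc_job.
Qed.

End Schedules.

(** * Word size and running time *)

Section Bounds.
Variables (m n p : nat).
Hypotheses (m_gt0 : 0 < m) (n_gt0 : 0 < n).

(** The exponent comes from the table: [base] is at most D ^ 4, so there are at most D ^ (8 * m)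
    states, and there are at most D ^ 5 rows. *)
Lemma word_bounds D : p < D -> 3 * m + n < D -> let X := D ^ (8 * m + 5) in
  [/\ 1 < X, 2 * n <= X, off m n <= X, (nrows m p n).+1 * nstates m p <= X
    & (n * p).+1 * D * D <= X].
Proof.
move=> pD nD X; have D5 : 4 < D by lia.
have powX k : k <= 8 * m + 5 -> D ^ k <= X by move=> h; rewrite leq_exp2l //; lia.
have DX : D <= X by rewrite -{1}[D]expn1 powX //; lia.
have D2X : D ^ 2 <= X by rewrite powX //; lia.
have D5X : D ^ 5 <= X by rewrite powX //; lia.
have M_le : (nslots m p).+1 <= D ^ 3.
  by rewrite /nslots !expnS expn0; nia.
have base_le : base m p <= D ^ 4.
  have : nslots m p * p.+1 <= D ^ 3.
    rewrite /nslots !expnS expn0 muln1 [p.+1 * m]mulnC -mulnA leq_mul //; first by lia.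
    by rewrite leq_mul.
  by rewrite /base [D ^ 4]expnS; move: (D ^ 3) M_le => y; nia.
split=> //; try lia.
- by apply: leq_trans D2X; rewrite expnS expn1; nia.
- by rewrite /off; lia.
- apply: (@leq_trans (D ^ 5 * D ^ (8 * m))); last by rewrite -expnD powX //; lia.
  apply: leq_mul.
    apply: (@leq_trans (n * D ^ 3).+1).
      by rewrite ltnS leq_mul2l M_le orbT.
    have : 0 < D ^ 3 by rewrite expn_gt0; lia.
    have -> : D ^ 5 = D * (D * D ^ 3) by rewrite -!expnS.
    move: (D ^ 3) => y y0.
    have : n.+1 * y <= D * y by rewrite leq_mul2r; lia.
    by have : 1 * (D * y) <= D * (D * y); [rewrite leq_mul2r; lia | lia].
  have -> : 8 * m = 4 * (2 * m) by lia.
  by rewrite expnM leq_exp2r //; lia.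
- apply: leq_trans D5X; have -> : D ^ 5 = D ^ 3 * D * D by rewrite -!expnSr.
  have np : (n * p).+1 <= D * D by have : n * p < D * D by [rewrite ltn_mul; lia].
  have D23 : D * D <= D ^ 3 by rewrite mulnn leq_exp2l //; lia.
  by rewrite !leq_mul2r (leq_trans np D23) !orbT.
Qed.

End Bounds.

Section Time.
Variable m : nat.
Hypothesis m_gt0 : 0 < m.

Definition cells_factor := (m + 2) * (2 * m + 2) ^ (2 * m) * 2 ^ (4 * m + 1).

(** There are O(p.+1 * a) rows of O(p.+1 ^ (4 * m)) states. For p > 0, p.+1 <= 2 * p gives a power
    of p; for p = 0 the summand n >= 1 takes over. *)
Lemma cells_bound n p a : 0 < n -> 0 < a ->
  (nrows m p a).+1 * nstates m p <=
  cells_factor * ((p ^ (4 * m + 2) + n) * a).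
Proof.
move=> n0 a0; set f := _ + n.
have f_ge : p.+1 ^ (4 * m + 1) <= 2 ^ (4 * m + 1) * f.
  case: p @f => [|q] f.
    by rewrite exp1n muln_gt0 expn_gt0 /= /f addn_gt0 n0 orbT.
  apply: (@leq_trans ((2 * q.+1) ^ (4 * m + 1))).
    by rewrite leq_exp2r; lia.
  rewrite expnMn leq_mul2l /f; apply/orP; right.
  by apply: leq_trans (leq_addr _ _); rewrite leq_pexp2l //; lia.
have base_le : base m p <= (2 * m + 2) * p.+1 ^ 2.
  by rewrite /base /nslots expnS expn1; nia.
have states_le : nstates m p <= (2 * m + 2) ^ (2 * m) * p.+1 ^ (4 * m).
  have -> : 4 * m = 2 * (2 * m) by lia.
  by rewrite (expnM p.+1 2) -expnMn leq_exp2r //; lia.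
have rows_le : (nrows m p a).+1 <= (m + 2) * a * p.+1.
  by rewrite /nrows /nslots; nia.
apply: leq_trans (leq_mul rows_le states_le) _.
have -> : cells_factor * (f * a) =
    (m + 2) * a * (2 * m + 2) ^ (2 * m) * (2 ^ (4 * m + 1) * f).
  by rewrite /cells_factor; lia.
have -> : (m + 2) * a * p.+1 * ((2 * m + 2) ^ (2 * m) * p.+1 ^ (4 * m)) =
    (m + 2) * a * (2 * m + 2) ^ (2 * m) * p.+1 ^ (4 * m + 1).
  by rewrite addn1 expnS; lia.
by rewrite leq_mul2l f_ge orbT.
Qed.

Section Bound.
Variables (n p a : nat).
Hypotheses (n_gt0 : 0 < n) (a_gt0 : 0 < a).
Notation h := ((p ^ (4 * m + 2) + n) * a).

Lemma h_gt0 : 0 < h.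
Proof. by rewrite muln_gt0 a_gt0 addn_gt0 n_gt0 orbT. Qed.

Definition decide_factor :=
  max_cost (set_budgets (iota 0 m)) +
  max_cost (r_g ::= (Reg r_N [+] Const 1) [*] Reg r_S) +
  (cells_factor + 1) * (max_cost (fill_cell m) + 2).

Lemma decide_time_bound : decide_time m p a <= decide_factor * h.
Proof.
have := cells_bound p n_gt0 a_gt0; have := h_gt0.
rewrite /decide_time /decide_factor; move: h (_ * nstates m p) => x q.
move: (max_cost _) (max_cost _) (max_cost _ + 2) cells_factor => A1 A2 A3 A4 x0 qx.
have : q.+1 * A3 <= (A4 * x + x) * A3 by rewrite leq_mul2r; lia.
by nia.
Qed.

Definition walk_factor :=
  max_cost (r_g ::= Const 0) + cells_factor * (max_cost (walk_cell m) + 6).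

Lemma walk_time_bound : walk_time m p a <= walk_factor * h.
Proof.
have := leq_trans (leq_pmulr _ (nstates_gt0 m p)) (cells_bound p n_gt0 a_gt0).
have := h_gt0; rewrite /walk_time /walk_factor; move: h (nrows m p a).+1 => x q.
move: (max_cost _) (max_cost _ + 6) cells_factor => A1 A2 A3 x0 qx.
have : q * A2 <= A3 * x * A2 by rewrite leq_mul2r qx orbT.
by nia.
Qed.

Definition output_factor :=
  max_cost (r_j ::= Const 0) + 2 * (max_cost (output_job m) + 4) +
  max_cost (Write (Const 0) (Const 1)).

Lemma n_le_h : n <= h.
Proof. by apply: leq_trans (leq_addl _ _) (leq_pmulr _ a_gt0). Qed.

Lemma output_time_bound : output_time m n <= output_factor * h.
Proof.
rewrite /output_time /output_factor.
have := n_le_h; have := h_gt0; move: h (max_cost _ + 4) => x A2.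
move: (max_cost _) (max_cost _) => A1 A3 x0 nx.
have : n.+1 * A2 <= 2 * x * A2 by rewrite leq_mul2r; lia.
by nia.
Qed.

Definition probe_factor :=
  max_cost (r_num ::= (Reg r_lo [+] Reg r_hi) [/] Const 2 [*] Read (Const (3 * 0 + 2))) +
  max_cost (r_den ::= Read (Const (3 * 0 + 1))) + decide_factor +
  max_cost (If (get m a_table (Const 0))
    (r_hi ::= (Reg r_lo [+] Reg r_hi) [/] Const 2 ;;
     If (Reg r_num [*] Reg r_bden [<] Reg r_bnum [*] Reg r_den)
       (r_bnum ::= Reg r_num ;; r_bden ::= Reg r_den) Skip)
    (r_lo ::= (Reg r_lo [+] Reg r_hi) [/] Const 2 [+] Const 1)).

Lemma probe_time_bound : probe_time m p a 0 <= probe_factor * h.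
Proof.
rewrite /probe_time /probe_factor; have := decide_time_bound; have := h_gt0.
move: h (decide_time m p a) decide_factor => x d D.
move: (max_cost _) (max_cost _) (max_cost _) => A1 A2 A3.
by nia.
Qed.

Definition search_factor :=
  m * (max_cost (r_lo ::= Const 0) +
       max_cost (r_hi ::= Reg r_n [*] Reg r_p [+] Const 1) +
       3 * (probe_factor + 4)) + 1.

Lemma search_time_bound : search_time m p a (2 * a) m <= search_factor * (h * a).
Proof.
rewrite /search_time /bisect_time /search_factor.
have := probe_time_bound; have := h_gt0.
move: h (probe_time m p a 0) probe_factor => x d D.
move: (max_cost _) (max_cost _) => A2 A1 x0 dx.
have l1 : (2 * a).+1 * (d + 4) <= 3 * a * (D * x + 4 * x) by rewrite leq_mul //; lia.
have l2 : A1 + (A2 + (2 * a).+1 * (d + 4)) <= (A1 + A2 + 3 * (D + 4)) * (x * a).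
  have xa : 0 < x * a by rewrite muln_gt0 x0.
  apply: (@leq_trans (A1 * (x * a) + (A2 * (x * a) + 3 * a * (D * x + 4 * x)))).
    by rewrite !leq_add // leq_pmulr.
  by lia.
rewrite [leqRHS]mulnDl mul1n -[m * _ * (x * a)]mulnA; apply: leq_add.
  by rewrite leq_mul2l l2 orbT.
by rewrite muln_gt0 x0.
Qed.

Definition read_factor :=
  max_cost (r_n ::= Read (Const 0)) +
  max_cost (r_off ::= Reg r_n [+] Const (3 * m + 1)) +
  2 * (max_cost (read_job m) + 4).

Lemma read_time_bound : read_time m n <= read_factor * h.
Proof.
rewrite /read_time /read_factor.
have := n_le_h; have := h_gt0; move: h (max_cost (read_job m) + 4) => x A2.
move: (max_cost _) (max_cost _) => A1 A3 x0 nx.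
have : n.+1 * A2 <= 2 * x * A2 by rewrite leq_mul2r; lia.
by nia.
Qed.

Lemma set_constants_time_bound :
  set_constants_time m a <= set_constants_time m 1 * h.
Proof.
have ah : a <= h by rewrite leq_pmull // addn_gt0 n_gt0 orbT.
rewrite /set_constants_time.
move: ah h_gt0; move: h (max_cost (next_pow m) + 6) => x A1 ax x0.
have : a.+1 * A1 <= 2 * x * A1 by rewrite leq_mul2r; lia.
move: (max_cost _) (max_cost _) (max_cost _) (max_cost _) => A2 A3 A4 A5.
move: (max_cost _) (max_cost _) (max_cost _) => A6 A7 A8.
by nia.
Qed.

Definition final_factor :=
  (cost (Reg r_bden)).+1 + max_cost (r_num ::= Reg r_bnum) +
  max_cost (r_den ::= Reg r_bden) + decide_factor + walk_factor + output_factor.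

Definition solve_factor :=
  read_factor + set_constants_time m 1 + search_factor + final_factor.

End Bound.

(** One factor [a] comes from the levels of the table, the other from the probes of the
    bisection. *)
Lemma solve_time_bound n P a : 0 < n -> 0 < a ->
  solve_time m n P a (2 * a) <=
  solve_factor * ((max_proc P n ^ (4 * m + 2) + n) * a ^ 2).
Proof.
move=> n0 a0; rewrite /solve_time -mulnn; set p := max_proc P n.
rewrite [_ * (a * a)]mulnA.
have := read_time_bound p n0 a0; have := set_constants_time_bound p n0 a0.
have := search_time_bound p n0 a0; have := decide_time_bound p n0 a0.
have := walk_time_bound p n0 a0; have := output_time_bound p n0 a0.
have := h_gt0 p n0 a0; rewrite /final_time -/p /solve_factor /final_factor.
move: (_ * a) => x; move: (cost (Reg r_bden)).+1 (max_cost _) (max_cost _) => A1 A2 A3.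
move: (read_time m n) (set_constants_time m a) (search_time _ _ _ _ _).
move=> T1 T2 T3; move: (decide_time m p a) (walk_time m p a) (output_time m n).
move=> T4 T5 T6; move: read_factor (set_constants_time m 1) search_factor.
move=> F1 F2 F3; move: decide_factor walk_factor output_factor => F4 F5 F6.
move=> x0 h6 h5 h4 h3 h2 h1.
have [xa l] : x <= x * a /\ A1 + (A2 + A3) <= (A1 + (A2 + A3)) * x.
  by rewrite !leq_pmulr.
have k F T : T <= F * x -> T <= F * (x * a).
  by move=> h; apply: leq_trans h _; rewrite leq_mul2l xa orbT.
have := k _ _ l; have := k _ _ h1; have := k _ _ h2; have := k _ _ h4.
have := k _ _ h5; have := k _ _ h6.
by rewrite !mulnDl; lia.
Qed.

End Time.

Unset Implicit Arguments.

Theorem theorem4 (m : nat) (hm : 0 < m) :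
  exists T : instance m -> nat,
    soft_O T (fun I : instance m => p_max I ^ (4 * m + 2) + njobs I) /\
    solvable_in_time T.
Proof.
pose f (I : instance m) := p_max I ^ (4 * m + 2) + njobs I.
pose T I := solve_factor m * (f I * (trunc_log 2 (f I)).+1 ^ 2).
exists T; split; first by exists (solve_factor m), 2 => I.
(* Stored values are at most X = magnitude ^ (8 * m + 5), and intermediate ones at most X to the
   power of the largest expression size. *)
exists (solve m), ((8 * m + 5) * max_expr_size (solve m)) => I.
pose a := (trunc_log 2 (f I)).+1.
have n0 := njobs_gt0 I.
have [pD nD numD denD] := input_le_magnitude I.
have [X2 nX offX cellX mkX] := word_bounds hm n0 pD nD.
have fa : f I < 2 ^ a by apply: trunc_log_ltn.
have na : njobs I < 2 ^ a by apply: leq_ltn_trans fa; apply: leq_addl.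
have pa : p_max I < 2 ^ a.
  apply: leq_ltn_trans fa; apply: leq_trans (leq_addr _ _).
  by case: (p_max I) => // q; rewrite -{1}[q.+1]expn1 leq_pexp2l //; lia.
(* With z = 2 ^ a > 1, both factors are at most z - 1, and (z - 1) ^ 2 + 1 < z ^ 2; so 2 * a
   halvings close the initial bracket. *)
have npa : (njobs I * p_max I).+1 < 2 ^ (2 * a).
  have : 1 < 2 ^ a by rewrite -{1}[2]expn1 leq_exp2l.
  rewrite [2 * a]mulnC expnM -mulnn; move: (2 ^ a) na pa => z nz pz z1.
  have : njobs I * p_max I <= z.-1 * z.-1 by rewrite leq_mul //; lia.
  by nia.
rewrite -(max_proc_job I) in cellX mkX npa.
have run := runs_solve hm n0 (input_encode I) (@speed_num_gt0 _ I)
  numD denD X2 nX offX cellX mkX na npa.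
have [|t [s [ex tT _ sol]]] := run.
  split=> [x|x] /=; first by [].
  apply: leq_trans (leq_addl (off m (njobs I)) _) _.
  apply: leq_trans (nth_encode_le I x) _.
  by rewrite -{1}[magnitude I]expn1 leq_pexp2l //; lia.
exists t, s; split; last exact: solution_correct.
  by rewrite expnM; apply: ex.
apply: leq_trans tT (leq_trans (solve_time_bound hm _ n0 (ltn0Sn _)) _).
by rewrite max_proc_job.
Qed.
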